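(* Let $(M,X,\omega)$ be a directed volume space and let $p>1$. If $(M,X,\omega)$ is $p$-traceable, then $$\int_M |X\varphi|^p\, \omega \;\geq\; \left(\frac{p-1}{p}\right)^p \int_M \frac{|\varphi|^p}{\tau_p^p}\, \omega \qquad \text{for all } \varphi\in C^1_c(M),$$ where $\tau_p:M\to\mathbb{R}$ is the temporal/volumetric distance of $(M,X,\omega)$.
   Context: Throughout, $M$ is a non-compact, oriented smooth manifold of dimension $N$. A directed volume space $(M,X,\omega)$ consists of $M$, a nowhere-vanishing smooth vector field $X$ on $M$ (a direction field) and a nowhere-vanishing smooth $N$-form $\omega$ on $M$ (a volume form), positive in the chosen orientation. $X\varphi$ is the derivative of the function $\varphi$ along $X$, and $C^1_c(M)$ is the space of compactly supported $C^1$ functions on $M$. For $z\in M$, $\gamma_z:I_z\to M$ denotes the maximal integral curve of $X$ with $\gamma_z(0)=z$. A subset $U\subseteq M$ is saturated if $\gamma_z(I_z)\subseteq U$ for all $z\in U$. Normal coordinates on an open set $U\subseteq M$ are (positively oriented) coordinates $(t,s)=(t,s^1,\dots,s^{N-1})$ on $U$ with $\partial/\partial t=X$. The local volume density in these coordinates is the positive function $\Omega(t,s)$ with $\omega=\Omega(t,s)\,dt\wedge ds$. For a saturated normal coordinate chart, the coordinate image has the form $\{(t,s): s\in S,\ t\in I_s\}$ with $S\subseteq\mathbb{R}^{N-1}$ open and each $I_s=(a_s,b_s)$ an open interval (possibly unbounded), each curve $s=\text{const}$ being a full maximal integral curve of $X$ (up to translation of time). For a measurable (nonnegative) function $f$ on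 an interval $I=(a,b)$, $-\infty\le a<b\le+\infty$, write $$\int_{\partial I}^t f(\xi)\,d\xi=\min\left(\int_a^t f(\xi)\,d\xi,\ \int_t^b f(\xi)\,d\xi\right),$$ divergent integrals being $+\infty$. Let $p>1$. A saturated normal chart domain $U$ with normal coordinates $(t,s)$, $t\in I_s$, is $p$-traceable if $\int_{\partial I_s}^t \Omega(\xi,s)^{-\frac1{p-1}}d\xi<\infty$ everywhere in $U$; in that case the temporal/volumetric distance on $U$ is $$\tau_p=\Omega(t,s)^{\frac1{p-1}}\int_{\partial I_s}^t\Omega(\xi,s)^{-\frac1{p-1}}\,d\xi .$$ Both notions are independent of the choice of normal coordinates, so these local functions define a function $\tau_p$ on $M$; $(M,X,\omega)$ is called $p$-traceable if $\tau_p$ is defined everywhere in $M$, i.e. if $M$ is covered by $p$-traceable saturated normal chart domains. *)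

(* Defs.v *)
From HB Require Import structures.
From mathcomp Require Import all_boot all_order all_algebra.
From mathcomp Require Import all_classical all_reals all_analysis.
Import numFieldNormedType.Exports.

Set Implicit Arguments.
Unset Strict Implicit.
Unset Printing Implicit Defensive.

Import Order.TTheory GRing.Theory Num.Theory.
Local Open Scope classical_set_scope.
Local Open Scope ring_scope.

(* The library's sigma-finite structure on [m1 \x m2] is shadowed by its
   subprobability structure, so it is put again on an alias of [m1 \x m2]. *)
Section SigmaFiniteProduct.
Local Open Scope ereal_scope.
Context d1 d2 (T1 : measurableType d1) (T2 : measurableType d2) (R : realType).
Variable m1 : {sigma_finite_measure set T1 -> \bar R}.
Variable m2 : {sigma_finite_measure set T2 -> \bar R}.

Definition sfprod : set (T1 * T2) -> \bar R := m1 \x m2.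

HB.instance Definition _ := Measure.copy sfprod (m1 \x m2).

Let sfprod_sigma_finite : sigma_finite setT sfprod.
Proof.
have /sigma_finiteP[F [TF ndF Foo]] := sigma_finiteT m1.
have /sigma_finiteP[G [TG ndG Goo]] := sigma_finiteT m2.
exists (fun n => F n `*` G n).
  rewrite -setXTT TF TG predeqE => -[x y]; split.
    move=> [/= [n _ Fnx] [k _ Gky]]; exists (maxn n k) => //; split.
    - by move: x Fnx; exact/subsetPset/ndF/leq_maxl.
    - by move: y Gky; exact/subsetPset/ndG/leq_maxr.
  by move=> [n _ []/= ? ?]; split; exists n.
move=> k; have [? ?] := Foo k; have [? ?] := Goo k.
split; first exact: measurableX.
rewrite /sfprod product_measure1E//.
by rewrite lte_mul_pinfty// ge0_fin_numE.
Qed.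

HB.instance Definition _ := Measure_isSigmaFinite.Build _ _ _ sfprod
  sfprod_sigma_finite.

End SigmaFiniteProduct.

(* Lebesgue measure on R^n is the n-fold product of the one-dimensional one; it
   lives on R * (R * (... * unit)), which [vec] identifies with 'rV[R]_n. *)
Record lebesgue_space (R : realType) (n : nat) := LebesgueSpace {
  ls_display : measure_display ;
  ls_carrier : measurableType ls_display ;
  ls_measure : {sigma_finite_measure set ls_carrier -> \bar R} ;
  ls_vec : ls_carrier -> 'rV[R]_n
}.

(* The point (t, s) of R x R^n = R^(n+1): [t] is the coordinate of index 0. *)
Definition pt (R : realType) (n : nat) (t : R) (s : 'rV[R]_n) : 'rV[R]_n.+1 :=
  row_mx (const_mx t : 'rV[R]_1) s.

Fixpoint lebesgueN (R : realType) (n : nat) : lebesgue_space R n :=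
  match n return lebesgue_space R n with
  | 0 => @LebesgueSpace R 0 _ unit (dirac tt) (fun _ => 0)
  | m.+1 =>
    let L := lebesgueN R m in
    @LebesgueSpace R m.+1 _ (measurableTypeR R * ls_carrier L)%type
      (sfprod (@lebesgue_measure R) (ls_measure L))
      (fun u => pt u.1 (ls_vec u.2))
  end.

Definition integralN (R : realType) (n : nat) (D : set 'rV[R]_n)
    (f : 'rV[R]_n -> \bar R) : \bar R :=
  (\int[ls_measure (lebesgueN R n)]_(u in [set u | D (ls_vec u)]) f (ls_vec u))%E.

(* Meaningful for an open set [U]: [f] is of class C^k on [U]. *)
Fixpoint Ck (R : realType) (V W : normedModType R) (k : nat) (U : set V)
    (f : V -> W) : Prop :=
  match k with
  | 0 => forall x, U x -> {for x, continuous f}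
  | k'.+1 => (forall x, U x -> differentiable f x) /\
             (forall v : V, Ck k' U (fun x => 'd f x v))
  end.

Definition smooth (R : realType) (V W : normedModType R) (U : set V)
    (f : V -> W) : Prop := forall k, Ck k U f.

(* The values of [to] outside [dom] and of [from] outside [img] are junk. *)
Record chart (R : realType) (N : nat) (M : topologicalType) := Chart {
  dom : set M ;
  img : set 'rV[R]_N ;
  to : M -> 'rV[R]_N ;
  from : 'rV[R]_N -> M ;
  dom_open : open dom ;
  img_open : open img ;
  to_img : forall x, dom x -> img (to x) ;
  from_dom : forall y, img y -> dom (from y) ;
  toK : forall x, dom x -> from (to x) = x ;
  fromK : forall y, img y -> to (from y) = y ;
  to_continuous : forall x, dom x -> {for x, continuous to} ;
  from_continuous : forall y, img y -> {for y, continuous from}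
}.

Definition transition (R : realType) (N : nat) (M : topologicalType)
    (c d : chart R N M) : 'rV[R]_N -> 'rV[R]_N := to d \o from c.

Definition oriented_compatible (R : realType) (N : nat) (M : topologicalType)
    (c d : chart R N M) : Prop :=
  smooth (to c @` (dom c `&` dom d)) (transition c d) /\
  forall x, dom c x -> dom d x -> 0 < \det ('J (transition c d) (to c x)).

(* An oriented smooth structure: a maximal atlas of positively oriented
   charts. *)
Record oriented_manifold (R : realType) (N : nat) (M : topologicalType) :=
  OrientedManifold {
  atlas : set (chart R N M) ;
  manifold_hausdorff : hausdorff_space M ;
  manifold_second_countable : @second_countable M ;
  atlas_cover : forall x, exists c, atlas c /\ dom c x ;
  atlas_compatible : forall c d, atlas c -> atlas d -> oriented_compatible c d ;
  atlas_maximal : forall c,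
    (forall d, atlas d -> oriented_compatible c d /\ oriented_compatible d c) ->
    atlas c
}.

(* A tangent vector field is given by its components [vfield c] in every chart
   [c], and an N-form by its density [density c], i.e. by
   omega = density c * dx^1 /\ ... /\ dx^N on [dom c]; [vfield c] and [density c]
   are only relevant on [dom c].  The dimension is n.+1, since a nonempty
   manifold of dimension 0 has no nowhere-vanishing vector field. *)
Record directed_volume_space (R : realType) (n : nat) (M : topologicalType) :=
  DirectedVolumeSpace {
  manifold :> oriented_manifold R n.+1 M ;
  noncompact : ~ compact [set: M] ;
  vfield : chart R n.+1 M -> M -> 'rV[R]_n.+1 ;
  field_smooth : forall c, atlas manifold c -> smooth (img c) (vfield c \o from c) ;
  field_change : forall c d x, atlas manifold c -> atlas manifold d ->
    dom c x -> dom d x ->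
    vfield d x = 'd (transition c d) (to c x) (vfield c x) ;
  field_neq0 : forall c x, atlas manifold c -> dom c x -> vfield c x != 0 ;
  density : chart R n.+1 M -> M -> R ;
  density_smooth : forall c, atlas manifold c ->
    smooth (img c) (density c \o from c : 'rV[R]_n.+1 -> R^o) ;
  density_change : forall c d x, atlas manifold c -> atlas manifold d ->
    dom c x -> dom d x ->
    density c x = density d x * \det ('J (transition c d) (to c x)) ;
  density_gt0 : forall c x, atlas manifold c -> dom c x -> 0 < density c x
}.

Definition borel (M : ptopologicalType) := g_sigma_algebraType (@open M).

(* [mu] is integration against the volume form omega: in every positively
   oriented chart, mu is density times Lebesgue measure.  As M is second
   countable, this determines [mu] on the Borel sets. *)
Definition volume_measure (R : realType) (n : nat) (M : ptopologicalType)
    (V : directed_volume_space R n M) (mu : {measure set (borel M) -> \bar R}) :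
    Prop :=
  forall c, atlas V c -> forall A : set (borel M), measurable A -> A `<=` dom c ->
    mu A = integralN (to c @` A) (fun y => (density V c (from c y))%:E).

Section DirectedVolumeSpace.
Context (R : realType) (n : nat) (M : topologicalType).
Variable V : directed_volume_space R n M.
Implicit Types (c : chart R n.+1 M) (p : R).

Definition chart_at (x : M) : chart R n.+1 M := projT1 (cid (atlas_cover V x)).

(* X phi; the value does not depend on the chart around [x]. *)
Definition Xderive (phi : M -> R) (x : M) : R :=
  let c := chart_at x in
  'D_(vfield V c x) (phi \o from c : 'rV[R]_n.+1 -> R^o) (to c x).

Definition C1c (phi : M -> R) : Prop :=
  (forall c, atlas V c -> Ck 1 (img c) (phi \o from c : 'rV[R]_n.+1 -> R^o)) /\
  compact (closure [set x | phi x != 0]).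

Definition integral_curve (J : set R) (gamma : R -> M) : Prop :=
  [/\ open J, is_interval J &
    forall t, J t -> {for t, continuous gamma} /\
      forall c, atlas V c -> dom c (gamma t) ->
        is_derive (t : R^o) 1 (to c \o gamma : R^o -> 'rV[R]_n.+1)
          (vfield V c (gamma t))].

Definition maximal_integral_curve (z : M) (J : set R) (gamma : R -> M) : Prop :=
  [/\ integral_curve J gamma, J 0, gamma 0 = z &
    forall J' gamma', integral_curve J' gamma' -> J `<=` J' ->
      (forall t, J t -> gamma' t = gamma t) -> J' `<=` J].

Definition saturated (U : set M) : Prop :=
  forall z J gamma, U z -> maximal_integral_curve z J gamma ->
    gamma @` J `<=` U.

Definition normal_chart c : Prop :=
  atlas V c /\ forall x, dom c x -> vfield V c x = delta_mx 0 0.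

Definition tcoord c (x : M) : R := to c x 0 0.

Definition scoord c (x : M) : 'rV[R]_n := rsubmx (to c x : 'rV[R]_(1 + n)).

(* I_s *)
Definition fiber c (s : 'rV[R]_n) : set R := [set t | img c (pt t s)].

(* The last condition says that I_s is an interval; openness of I_s, and the
   fact that s = const is a full maximal integral curve, then follow from the
   others. *)
Definition saturated_normal_chart c : Prop :=
  [/\ normal_chart c, saturated (dom c) & forall s, is_interval (fiber c s)].

(* Omega(t, s) *)
Definition Omega c (t : R) (s : 'rV[R]_n) : R := density V c (from c (pt t s)).

Definition boundary_integral (J : set R) (f : R -> R) (t : R) : \bar R :=
  Order.min (\int[@lebesgue_measure R]_(xi in J `&` `]-oo, t]) (f xi)%:E)%E
            (\int[@lebesgue_measure R]_(xi in J `&` `[t, +oo[) (f xi)%:E)%E.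

Definition chart_boundary_integral p c (x : M) : \bar R :=
  boundary_integral (fiber c (scoord c x))
    (fun xi => Omega c xi (scoord c x) `^ (- (p - 1)^-1)) (tcoord c x).

Definition traceable_chart p c : Prop :=
  saturated_normal_chart c /\
  forall x, dom c x -> (chart_boundary_integral p c x < +oo)%E.

Definition chart_tau p c (x : M) : R :=
  Omega c (tcoord c x) (scoord c x) `^ ((p - 1)^-1) *
  fine (chart_boundary_integral p c x).

Definition traceable p : Prop :=
  forall x, exists c, traceable_chart p c /\ dom c x.

(* The value does not depend on the p-traceable chart chosen around [x]; the
   default 0 is never used on a p-traceable space. *)
Definition tau p (x : M) : R :=
  match pselect (exists c, traceable_chart p c /\ dom c x) with
  | left e => chart_tau p (projT1 (cid e)) x
  | right _ => 0
  end.

End DirectedVolumeSpace.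

(* Main.v *)
From HB Require Import structures.
Require Import Defs.
From mathcomp Require Import all_boot all_order all_algebra.
From mathcomp Require Import all_classical all_reals all_analysis.
From mathcomp Require Import measurable_realfun ring lra.
Import numFieldNormedType.Exports.

Set Implicit Arguments.
Unset Strict Implicit.
Unset Printing Implicit Defensive.

Import Order.TTheory GRing.Theory Num.Theory.
Local Open Scope classical_set_scope.
Local Open Scope ring_scope.

(* By Fubini it suffices to prove the inequality on each fiber s = const of a
   p-traceable chart.  Put w = Omega(., s), g = w^(-1/(p-1)), q = p/(p-1), and let
   G be the integral of g over the part of the fiber on one side of t, so that
   G' = sigma g with sigma = 1 or -1.  Young's inequality gives pointwise
     |f|^p g G^(-p) + sigma q (|f|^p G^(1-p))' <= q^p |f'|^p w.
   Integrate it up to, and from, a point where the two one-sided integrals agree: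
   the boundary terms at that point have the right sign, and those at the ends
   vanish because f has compact support in the fiber.
   That compactness, the fact that a fiber meeting another chart is also a fiber
   of that chart, and the independence of tau from the chart come from one
   observation: integral curves are straight lines in a normal chart, and
   saturation forces a fiber to be a maximal integral curve.  Hence a countable
   cover by charts is made disjoint by removing whole fibers.
   Measurability of tau is never needed: the integral of |phi|^p / tau^p is the
   supremum of the integrals of the simple functions below it. *)

(** * One-dimensional Hardy inequality *)

(** The constant q^p comes from the profile f = G^((p-1)/p): there |f'| = |f| g / (q G), and this is
    the case of equality in Young's inequality. The factor Omega^(1/(p-1)) in tau fits the same
    computation, because it makes tau^(-p) w equal to g G^(-p) as soon as G is the smaller one-sided
    integral. Two obstacles shape the rest. Traceability bounds only the smaller of the two
    one-sided integrals. The other may diverge, and a point where they agree need not exist; the cut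
    is then placed at an end of a segment that carries the support, and one of the two halves
    degenerates. Moreover [saturated] speaks of maximal integral curves only, so a coordinate line
    of one normal chart has to be proved maximal before the saturation of another chart can say
    anything about it. *)

Section PowerNorm.
Context {R : realType}.
Implicit Types x r p : R.

Lemma continuous_powR_gt0 r x : 0 < x -> {for x, continuous (fun y => y `^ r)}.
Proof.
move=> x0; apply: differentiable_continuous; apply/derivable1_diffP.
by apply: derivable_powR; rewrite in_itv/= andbT.
Qed.

Lemma continuous_normr_powR r : 0 < r -> continuous (fun x : R => `|x| `^ r).
Proof.
move=> r0 x; have [->|x0] := eqVneq x 0; last first.
  apply: (@continuous_comp _ _ _ (fun x : R => `|x|) (fun y => y `^ r)).
    exact: norm_continuous.
  by apply: continuous_powR_gt0; rewrite normr_gt0.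
rewrite /prop_for /continuous_at normr0 powR0 ?gt_eqF//.
apply/cvgr0Pnorm_lt => e e0.
near=> y; rewrite ger0_norm ?powR_ge0//.
rewrite (_ : e = (e `^ r^-1) `^ r); last first.
  by rewrite -powRrM mulVf ?gt_eqF// powRr1// ltW.
rewrite gt0_ltr_powR// ?in_itv/= ?nnegrE ?powR_ge0//.
near: y; exists (e `^ r^-1) => [|z] /=; [rewrite powR_gt0 | rewrite sub0r normrN].
Unshelve. all: by end_near. Qed.

(** The derivative of |x|^p, that is p |x|^(p-1) times the sign of x. Splitting x into its positive
    and negative parts avoids the sign function, so that continuity at 0 follows from p - 1 > 0. *)
Definition dnorm_powR p x : R :=
  p * (Num.max x 0 `^ (p - 1) - Num.max (- x) 0 `^ (p - 1)).

Lemma continuous_dnorm_powR p : 1 < p -> continuous (dnorm_powR p).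
Proof.
move=> p1 x; rewrite /dnorm_powR.
have H (f : R -> R) : {for x, continuous f} ->
    {for x, continuous (fun y => Num.max (f y) 0 `^ (p - 1))}.
  move=> cf.
  rewrite (_ : (fun _ => _) = (fun y => `|y| `^ (p - 1)) \o
      (fun y => Num.max (f y) 0)); last first.
    apply/funext => y /=; rewrite ger0_norm//.
    by rewrite le_max lexx orbT.
  apply: continuous_comp; last by apply: continuous_normr_powR; rewrite subr_gt0.
  by apply: continuous_max => //; exact: cvg_cst.
apply: cvgM; first exact: cvg_cst.
apply: cvgB; first exact: (H idfun).
by apply: (H -%R); exact: opp_continuous.
Qed.

Lemma normr_dnorm_powR p x : 1 < p -> `|dnorm_powR p x| = p * `|x| `^ (p - 1).
Proof.
move=> p1; rewrite /dnorm_powR normrM gtr0_norm; last lra.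
congr (_ * _); have p10 : p - 1 != 0 by rewrite subr_eq0 gt_eqF.
have [x0|x0] := leP 0 x.
  rewrite (@max_r _ _ (- x)) ?oppr_le0// powR0// subr0.
  by rewrite ger0_norm ?powR_ge0// ger0_norm.
rewrite powR0// sub0r normrN max_l ?oppr_ge0 ?(ltW x0)//.
by rewrite ger0_norm ?powR_ge0// ltr0_norm.
Qed.

Lemma is_derive_normr_powR p x : 1 < p ->
  is_derive x 1 (fun y : R => `|y| `^ p) (dnorm_powR p x).
Proof.
move=> p1; have p10 : p - 1 != 0 by rewrite subr_eq0 gt_eqF.
have [x0|x0|->] := ltgtP x 0.
- apply: (@near_eq_is_derive _ _ _ (fun y => (- y) `^ p)).
    near=> y; rewrite ltr0_norm//; near: y; exact: lt_nbhsl.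
  have nx0 : 0 < - x by rewrite oppr_gt0.
  apply: is_derive_eq (is_derive1_comp (is_derive1_powR p nx0)
    (is_deriveNid x 1)) _.
  rewrite /dnorm_powR (max_r (ltW x0)) powR0// max_l; last by rewrite ltW.
  by rewrite mulrN1 -mulrN sub0r.
- apply: (@near_eq_is_derive _ _ _ (fun y => y `^ p)).
    near=> y; rewrite gtr0_norm//; near: y; exact: lt_nbhsr.
  apply: is_derive_eq (is_derive1_powR p x0) _.
  rewrite /dnorm_powR (max_l (ltW x0)) max_r; last by rewrite oppr_le0 ltW.
  by rewrite powR0// subr0.
(* At 0 the difference quotient has absolute value |h|^(p-1), which tends to 0 because p > 1. *)
- suff H : h^-1 *: (`|h *: (1 : R) + (0 : R)| `^ p - `|0 : R| `^ p)
      @[h --> (0 : R)^'] --> (0 : R).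
    split; first by apply/cvg_ex; exists 0.
    rewrite /dnorm_powR oppr0 subrr mulr0.
    by apply/cvg_lim => //.
  apply/cvgr0Pnorm_lt => e e0.
  have := @continuous_normr_powR (p - 1).
  rewrite subr_gt0 => /(_ p1 0); rewrite /continuous_at normr0 powR0//.
  move=> /cvgr0Pnorm_lt /(_ _ e0) H.
  near=> h.
  have h0 : h != 0 by near: h; exact: nbhs_dnbhs_neq.
  rewrite addr0 [_%:A]mulr1 powR0 ?subr0; last lra.
  rewrite normrM normfV (ger0_norm (powR_ge0 _ _)).
  rewrite -(@mulr_powRB1 _ `|h| p)//; last lra.
  rewrite mulrA mulVf ?normr_eq0// mul1r.
  rewrite -(ger0_norm (powR_ge0 `|h| _)).
  by near: h; apply: nbhs_dnbhs.
Unshelve. all: by end_near. Qed.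

End PowerNorm.

(** * Weighted Hardy inequality on a segment *)

Section HardyHalf.
Context {R : realType}.
Implicit Types p a b w G x y : R.

Lemma hardy_young p a b G w : 1 < p -> 0 <= a -> 0 <= b -> 0 < G -> 0 < w ->
  p / (p - 1) * (p * a `^ (p - 1) * b * G `^ (1 - p)) <=
  (p / (p - 1)) `^ p * (b `^ p * w) +
  (p - 1) * (a `^ p * w `^ (- (p - 1)^-1) * G `^ (- p)).
Proof.
move=> p1 a0 b0 G0 w0.
have p0 : 0 < p by lra.
have p10 : 0 < p - 1 by lra.
have q0 : 0 < p / (p - 1) by rewrite divr_gt0.
set q := p / (p - 1) in q0 *.
(* The powers of w cancel in X Y, while X^p carries w and Y^q carries w^(-1/(p-1)). The factor q in
   X gives the extremal profile equality. *)
pose X := q * b * w `^ p^-1.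
pose Y := (a / G) `^ (p - 1) * w `^ (- p^-1).
have X0 : 0 <= X by rewrite mulr_ge0 ?powR_ge0// mulr_ge0// ltW.
have Y0 : 0 <= Y by rewrite mulr_ge0 ?powR_ge0.
have pq : p^-1 + q^-1 = 1 by rewrite /q; field; rewrite !gt_eqF.
have := conjugate_powR X0 Y0 p0 q0 pq.
have Xp : X `^ p = q `^ p * (b `^ p * w).
  rewrite /X powRM ?powR_ge0 ?(mulr_ge0 (ltW q0))// powRM ?(ltW q0)// -powRrM.
  by rewrite mulVf ?gt_eqF// powRr1 ?mulrA// ltW.
have aG r : (a / G) `^ r = a `^ r * G `^ (- r).
  by rewrite powRM ?invr_ge0 ?(ltW G0)// -powR_inv1 ?(ltW G0)// -powRrM mulN1r.
have Yq : Y `^ q = a `^ p * w `^ (- (p - 1)^-1) * G `^ (- p).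
  rewrite /Y powRM ?powR_ge0// -!powRrM.
  have -> : (p - 1) * q = p by rewrite /q; field; rewrite gt_eqF.
  have -> : - p^-1 * q = - (p - 1)^-1.
    by rewrite /q; field; rewrite !gt_eqF.
  by rewrite aG mulrAC.
have XY : X * Y = q * (a `^ (p - 1) * b * G `^ (1 - p)).
  rewrite /X /Y aG opprB powRN.
  have : w `^ p^-1 != 0 by rewrite gt_eqF// powR_gt0.
  by move=> ?; field.
rewrite XY Xp Yq => /(ler_wpM2l (ltW p0)).
set u := _ * (b `^ p * w); set v := _ * G `^ (- p).
(* p / q = p - 1. *)
have -> : p * (u / p + v / q) = u + (p - 1) * v.
  by rewrite /q; field; rewrite !gt_eqF.
by apply: le_trans; rewrite le_eqVlt; apply/orP; left; apply/eqP; ring.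
Qed.

Lemma for_continuous_within (f : R -> R) (x y : R) :
  (forall t, x <= t <= y -> {for t, continuous f}) ->
  {within `[x, y], continuous f}.
Proof.
move=> cf; apply: continuous_in_subspaceT => t.
by rewrite inE/= in_itv/= => /cf.
Qed.

Lemma measurable_for_continuous (f : R -> R) (x y : R) :
  (forall t, x <= t <= y -> {for t, continuous f}) ->
  measurable_fun `[x, y] f.
Proof.
move=> /for_continuous_within.
by apply: subspace_continuous_measurable_fun.
Qed.

Lemma ftc_is_derive (f F : R -> R) (x y : R) : x <= y ->
  (forall t, x <= t <= y -> {for t, continuous f}) ->
  (forall t, x <= t <= y -> is_derive t 1 F (f t)) ->
  (\int[@lebesgue_measure R]_(t in `[x, y]) (f t)%:E = (F y - F x)%:E)%E.
Proof.
rewrite le_eqVlt => /predU1P[<- _ _|xy cf dF].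
  by rewrite set_itv1 integral_set1 subrr.
have cF t : x <= t <= y -> {for t, continuous F}.
  by move=> /dF [dFt _]; apply/differentiable_continuous/derivable1_diffP.
rewrite (@continuous_FTC2 _ _ F)//.
- exact: for_continuous_within.
- split.
  + by move=> t /[!in_itv]/= /andP[/ltW xt /ltW ty]; have [] := dF t _;
      rewrite ?xt.
  + by apply: cvg_at_right_filter; apply: cF; rewrite lexx ltW.
  + by apply: cvg_at_left_filter; apply: cF; rewrite lexx ltW.
- move=> t /[!in_itv]/= /andP[/ltW xt /ltW ty]; rewrite derive1E.
  by have [] := dF t _; rewrite ?xt.
Qed.

(** Both orientations are treated at once: for s = 1 the weight G grows away from the end x where f
    vanishes, and s = -1 is the mirror image. G is any positive primitive of s g, so it can be an
    integral that starts outside [x, y]. The boundary term of the integration by parts vanishes at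
    one end and is nonnegative at the other, once multiplied by s. *)
Lemma hardy_half p (f df w G : R -> R) (s x y : R) : 1 < p -> x <= y ->
  (forall t, x <= t <= y -> is_derive t 1 f (df t)) ->
  (forall t, x <= t <= y -> {for t, continuous df}) ->
  (forall t, x <= t <= y -> {for t, continuous w}) ->
  (forall t, x <= t <= y -> 0 < w t) ->
  (forall t, x <= t <= y -> 0 < G t) ->
  (forall t, x <= t <= y -> is_derive t 1 G (s * w t `^ (- (p - 1)^-1))) ->
  (s = 1 /\ f x = 0) \/ (s = -1 /\ f y = 0) ->
  (\int[@lebesgue_measure R]_(t in `[x, y])
     (`|f t| `^ p * w t `^ (- (p - 1)^-1) * G t `^ (- p))%:E <=
   ((p / (p - 1)) `^ p)%:E *
   \int[@lebesgue_measure R]_(t in `[x, y]) (`|df t| `^ p * w t)%:E)%E.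
Proof.
move=> p1 xy dF cdf cw w0 G0 dG sf.
have p0 : 0 < p by lra.
have p10 : 0 < p - 1 by lra.
have q0 : 0 < p / (p - 1) by rewrite divr_gt0.
set q := p / (p - 1) in q0 *.
have ss : s * s = 1 by case: sf => -[-> _]; ring.
have sn : `|s| = 1 by case: sf => -[-> _]; rewrite ?normrN normr1.
have cf t : x <= t <= y -> {for t, continuous f}.
  by move=> /dF [dFt _]; apply/differentiable_continuous/derivable1_diffP.
have cG t : x <= t <= y -> {for t, continuous G}.
  by move=> /dG [dFt _]; apply/differentiable_continuous/derivable1_diffP.
have cpw r (h : R -> R) t : {for t, continuous h} -> 0 < h t ->
    {for t, continuous (fun t => h t `^ r)}.
  move=> ch h0; apply: (@continuous_comp _ _ _ h (fun y => y `^ r)) => //.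
  exact: continuous_powR_gt0.
have cnpw r (h : R -> R) t : 0 < r -> {for t, continuous h} ->
    {for t, continuous (fun t => `|h t| `^ r)}.
  move=> r0 ch; apply: (@continuous_comp _ _ _ h (fun y => `|y| `^ r)) => //.
  exact: continuous_normr_powR.
pose g t := w t `^ (- (p - 1)^-1).
have cg t : x <= t <= y -> {for t, continuous g}.
  by move=> xty; apply: cpw; [exact: cw | exact: w0].
pose A t := `|f t| `^ p * g t * G t `^ (- p).
pose B t := `|df t| `^ p * w t.
pose H t := `|f t| `^ p * G t `^ (1 - p).
pose dH t := dnorm_powR p (f t) * df t * G t `^ (1 - p) +
  `|f t| `^ p * ((1 - p) * G t `^ (- p) * (s * g t)).
have dHE t : x <= t <= y -> is_derive t 1 H (dH t).
  move=> xty; have ? := G0 _ xty.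
  have D1 : is_derive t 1 (fun t => `|f t| `^ p) (dnorm_powR p (f t) * df t).
    exact: (@is_derive1_comp _ (fun y => `|y| `^ p) f t _ _
      (is_derive_normr_powR _ p1) (dF _ xty)).
  have D2 : is_derive t 1 (fun t => G t `^ (1 - p))
      ((1 - p) * G t `^ (- p) * (s * g t)).
    have := @is_derive1_comp _ (fun y => y `^ (1 - p)) G t _ _
      (is_derive1_powR (1 - p) (G0 _ xty)) (dG _ xty).
    by rewrite (_ : 1 - p - 1 = - p)//; ring.
  apply: is_derive_eq (is_deriveM D1 D2) _.
  by rewrite /dH /= /GRing.scale/=; ring.
have cA t : x <= t <= y -> {for t, continuous A}.
  move=> xty; apply: cvgM; first apply: cvgM.
  - by apply: cnpw => //; exact: cf.
  - exact: cg.
  - by apply: cpw; [exact: cG|exact: G0].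
have cB t : x <= t <= y -> {for t, continuous B}.
  move=> xty; apply: cvgM.
  - by apply: cnpw => //; exact: cdf.
  - exact: cw.
have cdH t : x <= t <= y -> {for t, continuous dH}.
  move=> xty.
  have c1 : {for t, continuous (fun t => G t `^ (1 - p))}.
    by apply: cpw; [exact: cG|exact: G0].
  have c2 : {for t, continuous (fun t => G t `^ (- p))}.
    by apply: cpw; [exact: cG|exact: G0].
  apply: cvgD.
    apply: cvgM => //; apply: cvgM; last exact: cdf.
    apply: (@continuous_comp _ _ _ f (dnorm_powR p)); first exact: cf.
    exact: continuous_dnorm_powR.
  apply: cvgM; first by apply: cnpw => //; exact: cf.
  apply: cvgM; last by apply: cvgM; [exact: cvg_cst|exact: cg].
  by apply: cvgM => //; exact: cvg_cst.
(* Since s^2 = 1 and q (p - 1) = p, the second summand of s q H' is - p A. It pays for the A on the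
   left and for the (p - 1) A that Young's inequality leaves on the right. *)
have AB t : x <= t <= y -> A t + s * q * dH t <= q `^ p * B t.
  move=> xty.
  have Y := hardy_young p1 (normr_ge0 (f t)) (normr_ge0 (df t)) (G0 _ xty) (w0 _ xty).
  have : s * q * (dnorm_powR p (f t) * df t * G t `^ (1 - p)) <=
      q * (p * `|f t| `^ (p - 1) * `|df t| * G t `^ (1 - p)).
    apply: le_trans (ler_norm _) _.
    rewrite normrM (normrM s) (normrM (_ * df t)) (normrM (dnorm_powR p (f t))).
    rewrite sn mul1r normr_dnorm_powR// (gtr0_norm q0).
    by rewrite (ger0_norm (powR_ge0 _ _)).
  move=> /le_trans /(_ Y); rewrite -/q -/(B t) -/(g t) -/(A t) => {}Y.
  rewrite /dH mulrDr.
  have -> : s * q * (`|f t| `^ p * ((1 - p) * G t `^ (- p) * (s * g t))) =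
      (s * s) * (- (q * (p - 1)) * A t) by rewrite /A; ring.
  rewrite ss mul1r.
  have -> : q * (p - 1) = p by rewrite /q; field; rewrite gt_eqF.
  move: Y; lra.
have A0 t : 0 <= A t by rewrite /A !mulr_ge0 ?powR_ge0.
have B0 t : x <= t <= y -> 0 <= B t.
  by move=> xty; rewrite /B mulr_ge0 ?powR_ge0// ltW// w0.
have mA := measurable_for_continuous cA.
have mB := measurable_for_continuous cB.
have mdH := measurable_for_continuous cdH.
have inxy t : [set` `[x, y]] t -> x <= t <= y by rewrite /= in_itv.
have iB : (@lebesgue_measure R).-integrable `[x, y] (EFin \o B).
  apply: continuous_compact_integrable; first exact: segment_compact.
  exact: for_continuous_within.
have idH : (@lebesgue_measure R).-integrable `[x, y] (EFin \o dH).
  apply: continuous_compact_integrable; first exact: segment_compact.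
  exact: for_continuous_within.
apply: (@le_trans _ _ (\int[@lebesgue_measure R]_(t in `[x, y])
   ((q `^ p)%:E * (B t)%:E - (s * q)%:E * (dH t)%:E))%E).
  apply: ge0_le_integral => //.
  - by move=> t /inxy xty; rewrite lee_fin A0.
  - exact/measurable_EFinP.
  - apply: emeasurable_funB; apply: emeasurable_funM => //;
      exact/measurable_EFinP.
  - move=> t /inxy xty; rewrite -!EFinM -EFinB lee_fin lerBrDr.
    exact: AB.
rewrite integralB//; last 2 first.
  - exact: integrableZl.
  - exact: integrableZl.
rewrite !integralZl//.
rewrite (ftc_is_derive xy cdH dHE).
rewrite leeBlDr; last by rewrite -EFinM.
rewrite leeDl// -EFinM lee_fin.
case: sf => -[-> f0]; rewrite /H f0 normr0 (@powR0 _ p) ?gt_eqF// mul0r.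
  by rewrite mul1r subr0 mulr_ge0 ?(ltW q0)// mulr_ge0 ?powR_ge0.
by rewrite sub0r mulN1r mulrNN mulr_ge0 ?(ltW q0)// mulr_ge0 ?powR_ge0.
Qed.

End HardyHalf.

(** * Integrals over the two sides of a point of an interval *)

Section OneSidedIntegrals.
Context {R : realType}.
Local Notation mu := (@lebesgue_measure R).
Variables (J : set R) (g : R -> R).
Hypotheses (oJ : open J) (iJ : is_interval J).
Hypothesis cg : forall t, J t -> {for t, continuous g}.
Hypothesis g0 : forall t, J t -> 0 < g t.

(** With [right_integral], the two quantities whose minimum is [boundary_integral]; either may be
    infinite. *)
Definition left_integral (t : R) : \bar R :=
  (\int[mu]_(xi in J `&` `]-oo, t]) (g xi)%:E)%E.

Definition right_integral (t : R) : \bar R :=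
  (\int[mu]_(xi in J `&` `[t, +oo[) (g xi)%:E)%E.

Lemma measurable_fun_continuous_open : measurable_fun J g.
Proof.
by apply: open_continuous_measurable_fun => // t; rewrite inE; exact: cg.
Qed.

Lemma segment_sub_interval s t : J s -> J t -> [set` `[s, t]] `<=` J.
Proof. by move=> Js Jt u /=; rewrite in_itv/=; exact: iJ. Qed.

Lemma open_margin t : J t -> exists a b, [/\ J a, J b, a < t & t < b].
Proof.
move=> Jt; have [e /= e0 Hb] := open_subball oJ Jt.
have h0 : 0 < e / 2 / 2 by rewrite !divr_gt0.
have H : ball t (e / 2) `<=` J.
  apply: Hb => //; last by rewrite divr_gt0.
  rewrite /= sub0r normrN gtr0_norm ?divr_gt0//.
  by rewrite ltr_pdivrMr// ltr_pMr// ltr1n.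
exists (t - e / 2 / 2), (t + e / 2 / 2); split; [apply: H|apply: H|lra|lra].
  by rewrite /ball/= opprB addrC subrK gtr0_norm//; lra.
by rewrite /ball/= opprD addrA subrr sub0r normrN gtr0_norm//; lra.
Qed.

Let mJ : measurable (J : set (measurableTypeR R)).
Proof. exact: is_interval_measurable. Qed.

Let mgS (A : set (measurableTypeR R)) : A `<=` J -> measurable_fun A (EFin \o g).
Proof.
move=> AJ; apply: (@measurable_funS _ _ _ _ J) => //.
by apply/measurable_EFinP; exact: measurable_fun_continuous_open.
Qed.

Let gE0 t : J t -> (0 <= (g t)%:E)%E.
Proof. by move=> Jt; rewrite lee_fin ltW// g0. Qed.

Lemma left_integral_cat s t : s <= t -> J s -> J t ->
  (left_integral t = left_integral s + \int[mu]_(xi in `[s, t]) (g xi)%:E)%E.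
Proof.
move=> st Js Jt.
have sub : [set` `]s, t]] `<=` J.
  by apply: subset_trans (segment_sub_interval Js Jt); exact: subset_itv_oc_cc.
have E : J `&` `]-oo, t] = (J `&` `]-oo, s]) `|` `]s, t].
  apply/seteqP; split => u /=; rewrite !in_itv/=.
    by move=> [Ju ut]; case: (leP u s) => us; [left|right].
  move=> [[Ju us]|/andP[su ut]]; first by split=> //; exact: le_trans st.
  by split => //; apply: sub; rewrite /= in_itv/= su.
rewrite /left_integral E ge0_integral_setU//.
- by rewrite integral_itv_obnd_cbnd//; exact: mgS.
- exact: measurableI.
- by apply: mgS => u [[]|]//; exact: sub.
- by move=> u [[Ju _]|/sub Ju]; exact: gE0.
- apply/disj_setPS => u /= [[_]]; rewrite !in_itv/= => us /andP[su _].
  by move: (lt_le_trans su us); rewrite ltxx.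
Qed.

Lemma right_integral_cat s t : s <= t -> J s -> J t ->
  (right_integral s = right_integral t + \int[mu]_(xi in `[s, t]) (g xi)%:E)%E.
Proof.
move=> st Js Jt.
have sub : [set` `[s, t[] `<=` J.
  by apply: subset_trans (segment_sub_interval Js Jt); exact: subset_itv_co_cc.
have E : J `&` `[s, +oo[ = (J `&` `[t, +oo[) `|` `[s, t[.
  apply/seteqP; split => u /=; rewrite !in_itv/= !andbT.
    by move=> [Ju su]; case: (leP t u) => tu; [left|right; rewrite su].
  move=> [[Ju us]|/andP[su ut]]; first by split=> //; exact: le_trans us.
  by split => //; apply: sub; rewrite /= in_itv/= su.
rewrite /right_integral E ge0_integral_setU//.
- by rewrite integral_itv_bndo_bndc//; exact: mgS.
- exact: measurableI.
- by apply: mgS => u [[]|]//; exact: sub.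
- by move=> u [[Ju _]|/sub Ju]; exact: gE0.
- apply/disj_setPS => u /= [[_]]; rewrite !in_itv/= andbT => us /andP[_ su].
  by move: (lt_le_trans su us); rewrite ltxx.
Qed.

Lemma left_integral_ge0 t : (0 <= left_integral t)%E.
Proof. by apply: integral_ge0 => u [Ju _]; exact: gE0. Qed.

Lemma right_integral_ge0 t : (0 <= right_integral t)%E.
Proof. by apply: integral_ge0 => u [Ju _]; exact: gE0. Qed.

Let cgJ s t : J s -> J t -> forall u, s <= u <= t -> {for u, continuous g}.
Proof. by move=> Js Jt u sut; apply: cg; exact: iJ sut. Qed.

Let ig s t : J s -> J t -> mu.-integrable `[s, t] (EFin \o g).
Proof.
move=> Js Jt; apply: continuous_compact_integrable; first exact: segment_compact.
apply: for_continuous_within; exact: cgJ.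
Qed.

Lemma segment_integral_fin s t : J s -> J t ->
  (\int[mu]_(xi in `[s, t]) (g xi)%:E)%E \is a fin_num.
Proof. by move=> Js Jt; apply: integrable_fin_num => //; exact: ig. Qed.

(** On a segment the continuous g has a positive minimum, which is integrated instead. *)
Lemma segment_integral_gt0 s t : s < t -> J s -> J t ->
  (0 < \int[mu]_(xi in `[s, t]) (g xi)%:E)%E.
Proof.
move=> st Js Jt.
have [c cin cmin] := EVT_min (ltW st) (for_continuous_within (cgJ Js Jt)).
have Jc : J c by apply: iJ Js Jt _ _; move: cin; rewrite in_itv.
have H : (0 < (g c)%:E * (t - s)%:E)%E.
  by rewrite -EFinM lte_fin mulr_gt0 ?g0// subr_gt0.
apply: lt_le_trans H _.
have -> : ((g c)%:E * (t - s)%:E = \int[mu]_(xi in `[s, t]) cst (g c)%:E xi)%E.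
  by rewrite integral_cst//= lebesgue_measure_itv/= lte_fin st -EFinD.
apply: ge0_le_integral => //.
- by move=> u _; exact: gE0.
- by apply: mgS; exact: segment_sub_interval.
Qed.

Lemma left_integral_le s t : s <= t -> J s -> J t ->
  (left_integral s <= left_integral t)%E.
Proof.
move=> st Js Jt; rewrite (left_integral_cat st)// leeDl// integral_ge0// => u.
by move=> /(segment_sub_interval Js Jt); exact: gE0.
Qed.

Lemma right_integral_le s t : s <= t -> J s -> J t ->
  (right_integral t <= right_integral s)%E.
Proof.
move=> st Js Jt; rewrite (right_integral_cat st)// leeDl// integral_ge0// => u.
by move=> /(segment_sub_interval Js Jt); exact: gE0.
Qed.

Lemma left_integral_gt0 t : J t -> (0 < left_integral t)%E.
Proof.
move=> Jt; have [a [b [Ja _ at_ _]]] := open_margin Jt.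
apply: lt_le_trans (segment_integral_gt0 at_ Ja Jt) _.
by rewrite (left_integral_cat (ltW at_))// leeDr// left_integral_ge0.
Qed.

Lemma right_integral_gt0 t : J t -> (0 < right_integral t)%E.
Proof.
move=> Jt; have [a [b [_ Jb _ tb]]] := open_margin Jt.
apply: lt_le_trans (segment_integral_gt0 tb Jt Jb) _.
by rewrite (right_integral_cat (ltW tb))// leeDr// right_integral_ge0.
Qed.

(** Two values differ by the integral of a continuous function over a segment inside J. Divergence
    is therefore a matter of the left end of J and not of the point. *)
Lemma left_integral_fin s t : J s -> J t ->
  (left_integral s < +oo)%E -> left_integral t \is a fin_num.
Proof.
move=> Js Jt sfin; rewrite ge0_fin_numE ?left_integral_ge0//.
have [ts|st] := leP t s; first exact: le_lt_trans (left_integral_le ts _ _) sfin.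
rewrite (left_integral_cat (ltW st))// lte_add_pinfty//.
by have := segment_integral_fin Js Jt; rewrite fin_numE ltey => /andP[].
Qed.

Lemma right_integral_fin s t : J s -> J t ->
  (right_integral s < +oo)%E -> right_integral t \is a fin_num.
Proof.
move=> Js Jt sfin; rewrite ge0_fin_numE ?right_integral_ge0//.
have [st|ts] := leP s t; first exact: le_lt_trans (right_integral_le st _ _) sfin.
rewrite (right_integral_cat (ltW ts))// lte_add_pinfty//.
by have := segment_integral_fin Jt Js; rewrite fin_numE ltey => /andP[].
Qed.

Let is_derive_segment_integral a b t : J a -> J b -> a < t < b ->
  is_derive t 1 (fun u => \int[mu]_(xi in `[a, u]) g xi) (g t).
Proof.
move=> Ja Jb /andP[at_ tb].
have Jt : J t by apply: iJ Ja Jb _ _; rewrite !ltW.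
have [D E] := continuous_FTC1_closed tb (ig Ja Jb) at_ (cg Jt).
by split; [exact: D|rewrite -derive1E E].
Qed.

Lemma is_derive_left_integral s t : J s -> J t -> (left_integral s < +oo)%E ->
  is_derive t 1 (fun u => fine (left_integral u)) (g t).
Proof.
move=> Js Jt sfin; have [a [b [Ja Jb at_ tb]]] := open_margin Jt.
apply: (@near_eq_is_derive _ _ _ (fun u => fine (left_integral a) +
    \int[mu]_(xi in `[a, u]) g xi)).
  near=> u.
  have au : a < u by near: u; exact: lt_nbhsr.
  have ub : u < b by near: u; exact: lt_nbhsl.
  have Ju : J u by apply: iJ Ja Jb _ _; rewrite !ltW.
  by rewrite (left_integral_cat (ltW au))// (fineD (left_integral_fin Js Ja sfin)
    (segment_integral_fin Ja Ju)).
have abt : a < t < b by rewrite at_.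
have := is_deriveD (is_derive_cst (fine (left_integral a) : R) t 1)
  (is_derive_segment_integral Ja Jb abt).
by rewrite add0r.
Unshelve. all: by end_near. Qed.

Lemma is_derive_right_integral s t : J s -> J t -> (right_integral s < +oo)%E ->
  is_derive t 1 (fun u => fine (right_integral u)) (- g t).
Proof.
move=> Js Jt sfin; have [a [b [Ja Jb at_ tb]]] := open_margin Jt.
(* The base point lies to the left of t here too, so the derivative again comes from
   [is_derive_segment_integral], now with a minus sign. *)
apply: (@near_eq_is_derive _ _ _ (fun u => fine (right_integral a) -
    \int[mu]_(xi in `[a, u]) g xi)).
  near=> u.
  have au : a < u by near: u; exact: lt_nbhsr.
  have ub : u < b by near: u; exact: lt_nbhsl.
  have Ju : J u by apply: iJ Ja Jb _ _; rewrite !ltW.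
  by rewrite (right_integral_cat (ltW au))// (fineD (right_integral_fin Js Ju sfin)
    (segment_integral_fin Ja Ju)) addrK.
have abt : a < t < b by rewrite at_.
have := is_deriveB (is_derive_cst (fine (right_integral a) : R) t 1)
  (is_derive_segment_integral Ja Jb abt).
by rewrite sub0r.
Unshelve. all: by end_near. Qed.

(** The left integral increases with the point and the right one decreases. Either their order is
    the same all along [a, b], and m is an end, or the intermediate value theorem finds a point of
    equality. *)
Lemma one_sided_integrals_cross a b : a <= b -> J a -> J b ->
  exists m, [/\ a <= m <= b,
    m = a \/ (left_integral m <= right_integral m)%E &
    m = b \/ (right_integral m <= left_integral m)%E].
Proof.
move=> ab Ja Jb.
have [LRb|RLb] := leP (left_integral b) (right_integral b).
  by exists b; split; [rewrite ab lexx|right|left].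
have [RLa|LRa] := leP (right_integral a) (left_integral a).
  by exists a; split; [rewrite ab lexx|left|right].
(* A strict inequality makes its smaller side finite. Finiteness spreads over J, so the difference d
   is a genuine real function on [a, b]. *)
have Rb : (right_integral b < +oo)%E by exact: lt_le_trans RLb (leey _).
have La : (left_integral a < +oo)%E by exact: lt_le_trans LRa (leey _).
pose d u := fine (left_integral u) - fine (right_integral u).
have Jab t : a <= t <= b -> J t by exact: iJ.
have cd t : a <= t <= b -> {for t, continuous d}.
  move=> /Jab Jt; apply: cvgB.
    have [D _] := is_derive_left_integral Ja Jt La.
    exact/differentiable_continuous/derivable1_diffP.
  have [D _] := is_derive_right_integral Jb Jt Rb.
  exact/differentiable_continuous/derivable1_diffP.
have da : d a <= 0.
  rewrite subr_le0 fine_le ?(ltW LRa)//.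
    exact: left_integral_fin La.
  exact: right_integral_fin Rb.
have db : 0 <= d b.
  rewrite subr_ge0 fine_le ?(ltW RLb)//.
    exact: right_integral_fin Rb.
  exact: left_integral_fin La.
have [|m mab dm] := IVT (v := 0) ab (for_continuous_within cd).
  by rewrite ge_min da/= le_max db orbT.
have {}mab : a <= m <= b by move: mab; rewrite in_itv.
have E : left_integral m = right_integral m.
  rewrite -(fineK (left_integral_fin Ja (Jab _ mab) La)).
  rewrite -(fineK (right_integral_fin Jb (Jab _ mab) Rb)).
  by congr EFin; apply/eqP; rewrite -subr_eq0; apply/eqP.
by exists m; split => //; right; rewrite E.
Qed.

End OneSidedIntegrals.

(** * Hardy inequality on a whole fiber *)

Section HardyFiber.
Context {R : realType}.
Local Notation mu := (@lebesgue_measure R).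
(** [k] stands for a simple function below |f|^p / tau^p, multiplied by the density w; measurability
    is asked of [k], not of the quotient that bounds it. *)
Variables (p : R) (J : set R) (w f df k : R -> R).
Let g t := w t `^ (- (p - 1)^-1).
Let F t := fine (boundary_integral J g t).
Hypotheses (p1 : 1 < p) (oJ : open J) (iJ : is_interval J).
Hypothesis w0 : forall t, J t -> 0 < w t.
Hypothesis cw : forall t, J t -> {for t, continuous w}.
Hypothesis Ffin : forall t, J t -> (boundary_integral J g t < +oo)%E.
Hypothesis dfE : forall t, J t -> is_derive t 1 f (df t).
Hypothesis cdf : forall t, J t -> {for t, continuous df}.
Hypothesis mk : measurable_fun J k.
Hypothesis k0 : forall t, 0 <= k t.
Hypothesis kle : forall t, J t ->
  k t <= `|f t| `^ p / (w t `^ (p - 1)^-1 * F t) `^ p * w t.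

Let p0 : 0 < p.
Proof. exact: lt_trans p1. Qed.

Let g0 t : J t -> 0 < g t.
Proof. by move=> /w0 ?; rewrite powR_gt0. Qed.

Let cg t : J t -> {for t, continuous g}.
Proof.
move=> Jt; apply: (@continuous_comp _ _ _ w (fun y => y `^ _)); first exact: cw.
by apply: continuous_powR_gt0; exact: w0.
Qed.

Let mJ : measurable (J : set (measurableTypeR R)).
Proof. exact: is_interval_measurable. Qed.

Let q := p / (p - 1).
Let A (G : R -> R) t := `|f t| `^ p * g t * G t `^ (- p).
Let B t := `|df t| `^ p * w t.

(** The identity 1 - p/(p-1) = -1/(p-1) between exponents turns the power of w in tau^(-p) w into
    g. *)
Let kA t : J t -> k t <= A F t.
Proof.
move=> Jt; apply: le_trans (kle Jt) _; rewrite /A /g.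
have wt := w0 Jt; have F0 : 0 <= F t.
  apply: fine_ge0; rewrite /boundary_integral le_min.
  by rewrite left_integral_ge0// right_integral_ge0.
rewrite powRM ?powR_ge0// invfM -!powRN -powRrM.
have -> : - (p - 1)^-1 = (p - 1)^-1 * - p + 1 by field; rewrite subr_eq0 gt_eqF.
rewrite powRD ?powRr1 ?(ltW wt)//; last by rewrite (gt_eqF wt) implybT.
by rewrite le_eqVlt; apply/orP; left; apply/eqP; ring.
Qed.

Let J_segment a b t : J a -> J b -> a <= t <= b -> J t.
Proof. by move=> Ja Jb; exact: iJ. Qed.

Let B0 t : J t -> 0 <= B t.
Proof. by move=> /w0 ?; rewrite /B mulr_ge0 ?powR_ge0// ltW. Qed.

Let measurable_B : measurable_fun J B.
Proof.
apply: measurable_fun_continuous_open => // t Jt; apply: cvgM; last exact: cw.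
apply: (@continuous_comp _ _ _ df (fun y => `|y| `^ p)); first exact: cdf.
exact: continuous_normr_powR.
Qed.

Let continuous_A (G : R -> R) t : J t -> {for t, continuous G} -> 0 < G t ->
  {for t, continuous (A G)}.
Proof.
move=> Jt cG G0.
have c1 : {for t, continuous (fun t => `|f t| `^ p)}.
  apply: (@continuous_comp _ _ _ f (fun y => `|y| `^ p)).
    by have [D _] := dfE Jt; exact/differentiable_continuous/derivable1_diffP.
  exact: continuous_normr_powR.
have c2 : {for t, continuous (fun t => G t `^ (- p))}.
  apply: (@continuous_comp _ _ _ G (fun y => y `^ - p)) => //.
  exact: continuous_powR_gt0.
by apply: cvgM => //; apply: cvgM => //; exact: cg.
Qed.

(** If the left integral is the smaller one at b, monotonicity keeps it so on all of [a, b]. There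
    [boundary_integral] is the left integral, hence finite and a primitive of g. In the case a = b
    both sides are 0. *)
Let hardy_left a b : a <= b -> J a -> J b -> f a = 0 ->
  a = b \/ (left_integral J g b <= right_integral J g b)%E ->
  (\int[mu]_(t in `[a, b]) (k t)%:E <=
   (q `^ p)%:E * \int[mu]_(t in `[a, b]) (B t)%:E)%E.
Proof.
move=> ab Ja Jb fa [<-|LR]; first by rewrite set_itv1 !integral_set1 mule0.
have Jt t : a <= t <= b -> J t by exact: J_segment.
have FE t : a <= t <= b -> boundary_integral J g t = left_integral J g t.
  move=> abt; rewrite /boundary_integral min_l//.
  have /andP[_ tb] := abt.
  apply: le_trans (left_integral_le oJ iJ cg g0 tb (Jt _ abt) Jb) _.
  exact: le_trans LR (right_integral_le oJ iJ cg g0 tb (Jt _ abt) Jb).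
have Lfin : (left_integral J g b < +oo)%E.
  by rewrite -FE ?ab ?lexx//; exact: Ffin.
apply: le_trans (@hardy_half _ p f df w (fun t => fine (left_integral J g t)) 1 a b
    p1 ab _ _ _ _ _ _ _).
- apply: ge0_le_integral => //.
  + by move=> t _; rewrite lee_fin.
  + by apply/measurable_EFinP; apply: measurable_funS mk.
  + apply/measurable_EFinP; apply: measurable_for_continuous => t abt.
    have Jtt := Jt _ abt.
    apply: (@continuous_A (fun t => fine (left_integral J g t))) => //.
      have [D _] := is_derive_left_integral oJ iJ cg g0 Jb Jtt Lfin.
      exact/differentiable_continuous/derivable1_diffP.
    rewrite fine_gt0// left_integral_gt0//=.
    by have := left_integral_fin oJ iJ cg g0 Jb Jtt Lfin;
      rewrite fin_numElt => /andP[].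
  + move=> t /=; rewrite in_itv/= => abt; rewrite lee_fin.
    by apply: le_trans (kA (Jt _ abt)) _; rewrite /A /F FE.
- by move=> t /Jt; exact: dfE.
- by move=> t /Jt; exact: cdf.
- by move=> t /Jt; exact: cw.
- by move=> t /Jt; exact: w0.
- move=> t /Jt Jtt; rewrite fine_gt0// left_integral_gt0//=.
  by have := left_integral_fin oJ iJ cg g0 Jb Jtt Lfin;
    rewrite fin_numElt => /andP[].
- move=> t /Jt Jtt; rewrite mul1r; exact: is_derive_left_integral Lfin.
- by left.
Qed.

(** Mirror image of [hardy_left]: the right integral has derivative - g, which is the case s = -1 of
    [hardy_half]. *)
Let hardy_right a b : a <= b -> J a -> J b -> f b = 0 ->
  a = b \/ (right_integral J g a <= left_integral J g a)%E ->
  (\int[mu]_(t in `[a, b]) (k t)%:E <=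
   (q `^ p)%:E * \int[mu]_(t in `[a, b]) (B t)%:E)%E.
Proof.
move=> ab Ja Jb fb [<-|RL]; first by rewrite set_itv1 !integral_set1 mule0.
have Jt t : a <= t <= b -> J t by exact: J_segment.
have FE t : a <= t <= b -> boundary_integral J g t = right_integral J g t.
  move=> abt; rewrite /boundary_integral min_r//.
  have /andP[at_ _] := abt.
  apply: le_trans (right_integral_le oJ iJ cg g0 at_ Ja (Jt _ abt)) _.
  exact: le_trans RL (left_integral_le oJ iJ cg g0 at_ Ja (Jt _ abt)).
have Rfin : (right_integral J g a < +oo)%E.
  by rewrite -FE ?ab ?lexx//; exact: Ffin.
apply: le_trans (@hardy_half _ p f df w (fun t => fine (right_integral J g t)) (-1) a b
    p1 ab _ _ _ _ _ _ _).
- apply: ge0_le_integral => //.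
  + by move=> t _; rewrite lee_fin.
  + by apply/measurable_EFinP; apply: measurable_funS mk.
  + apply/measurable_EFinP; apply: measurable_for_continuous => t abt.
    have Jtt := Jt _ abt.
    apply: (@continuous_A (fun t => fine (right_integral J g t))) => //.
      have [D _] := is_derive_right_integral oJ iJ cg g0 Ja Jtt Rfin.
      exact/differentiable_continuous/derivable1_diffP.
    rewrite fine_gt0// right_integral_gt0//=.
    by have := right_integral_fin oJ iJ cg g0 Ja Jtt Rfin;
      rewrite fin_numElt => /andP[].
  + move=> t /=; rewrite in_itv/= => abt; rewrite lee_fin.
    by apply: le_trans (kA (Jt _ abt)) _; rewrite /A /F FE.
- by move=> t /Jt; exact: dfE.
- by move=> t /Jt; exact: cdf.
- by move=> t /Jt; exact: cw.
- by move=> t /Jt; exact: w0.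
- move=> t /Jt Jtt; rewrite fine_gt0// right_integral_gt0//=.
  by have := right_integral_fin oJ iJ cg g0 Ja Jtt Rfin;
    rewrite fin_numElt => /andP[].
- move=> t /Jt Jtt; rewrite mulN1r; exact: is_derive_right_integral Rfin.
- by right.
Qed.

Let integral_segment_cat (h : R -> R) a m b : measurable_fun J h ->
  (forall t, J t -> 0 <= h t) -> J a -> J b -> a <= m <= b ->
  (\int[mu]_(t in `[a, b]) (h t)%:E =
   \int[mu]_(t in `[a, m]) (h t)%:E + \int[mu]_(t in `[m, b]) (h t)%:E)%E.
Proof.
move=> mh h0 Ja Jb /andP[am mb].
have Jt t : a <= t <= b -> J t by exact: J_segment.
have mhS (S : set (measurableTypeR R)) : S `<=` J -> measurable_fun S (EFin \o h).
  by move=> SJ; apply/measurable_EFinP; apply: measurable_funS mh.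
have sub : [set` `]m, b]] `<=` J.
  move=> t /=; rewrite in_itv/= => /andP[mt tb]; apply: Jt.
  by rewrite tb (le_trans am)// ltW.
have sub2 : [set` `[a, m]] `<=` J.
  move=> t /=; rewrite in_itv/= => /andP[at_ tm]; apply: Jt.
  by rewrite at_ (le_trans tm).
rewrite (@itv_bndbnd_setU _ _ (BLeft a) (BRight m) (BRight b)) ?bnd_simp//.
rewrite ge0_integral_setU//.
- by rewrite integral_itv_obnd_cbnd//; exact: mhS.
- by apply: mhS => t [/sub2|/sub].
- by move=> t [/sub2|/sub] Jtt; rewrite lee_fin h0.
- apply/disj_setPS => t /=; rewrite !in_itv/= => -[/andP[_ tm] /andP[mt _]].
  by move: (lt_le_trans mt tm); rewrite ltxx.
Qed.

Lemma hardy_fiber a b : (forall t, J t -> ~~ (a <= t <= b) -> f t = 0) ->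
  J a -> J b ->
  (\int[mu]_(t in J) (k t)%:E <=
   (q `^ p)%:E * \int[mu]_(t in J) (`|df t| `^ p * w t)%:E)%E.
Proof.
move=> fsupp Ja Jb.
(* f may be nonzero at a and b. As J is open there are points of J beyond them, and f vanishes
   there. *)
have [a' [_ [Ja' _ aa' _]]] := open_margin oJ Ja.
have [_ [b' [_ Jb' _ bb']]] := open_margin oJ Jb.
have fa' : f a' = 0 by apply: fsupp => //; rewrite leNgt aa'.
have fb' : f b' = 0 by apply: fsupp => //; rewrite andbC leNgt bb'.
(* a <= b is not assumed: if f vanishes on all of J the two ends may come in the wrong order. The
   minimum restores it, and f is 0 at either candidate. *)
pose c := Num.min a' b'.
have [cb Jc fc] : [/\ c <= b', J c & f c = 0].
  by rewrite /c; case: (leP a' b') => //.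
have Jt t : c <= t <= b' -> J t by exact: J_segment.
have [m [cmb m1 m2]] := one_sided_integrals_cross oJ iJ cg g0 cb Jc Jb'.
have Jm := Jt _ cmb; have /andP[cm mb] := cmb.
have -> : (\int[mu]_(t in J) (k t)%:E = \int[mu]_(t in `[c, b']) (k t)%:E)%E.
  rewrite [RHS](_ : _ = \int[mu]_(t in J `&` `[c, b']) (k t)%:E)%E; last first.
    by congr (integral _ _ _); rewrite setIidr//; exact: (segment_sub_interval iJ).
  rewrite integral_mkcondr; apply: eq_integral => t; rewrite inE => Jtt.
  rewrite patchE; case: ifPn => // /negP; rewrite inE/= in_itv/= => tcb.
  have kt : k t <= 0.
    apply: le_trans (kA Jtt) _; rewrite /A fsupp ?normr0 ?powR0 ?mul0r//.
      by rewrite gt_eqF.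
    apply/negP => /andP[at_ tb]; apply: tcb; apply/andP; split; last first.
      exact: le_trans (ltW bb').
    by rewrite /c ge_min (le_trans (ltW aa')).
  by congr EFin; apply/eqP; rewrite eq_le kt k0.
rewrite (integral_segment_cat mk _ Jc Jb' cmb)//.
apply: (@le_trans _ _ ((q `^ p)%:E * \int[mu]_(t in `[c, b']) (B t)%:E)%E).
  rewrite (integral_segment_cat measurable_B _ Jc Jb' cmb)//.
  rewrite ge0_muleDr; last 2 first.
  - apply: integral_ge0 => t /=; rewrite in_itv/= => /(J_segment Jc Jm) Jtt.
    by rewrite lee_fin B0.
  - apply: integral_ge0 => t /=; rewrite in_itv/= => /(J_segment Jm Jb') Jtt.
    by rewrite lee_fin B0.
  apply: leeD; last exact: hardy_right.
  by apply: hardy_left => //; case: m1 => [->|]; [left|right].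
rewrite lee_wpmul2l ?lee_fin ?powR_ge0//.
apply: ge0_subset_integral => //.
- exact/measurable_EFinP.
Qed.

End HardyFiber.

(** * Integral curves in normal charts *)

Section Lines.
Context {R : realType} {n : nat}.
Implicit Types y : 'rV[R]_n.+1.

(** The flow of d/dt: [delta_mx 0 0] is the value of the field in every normal chart. *)
Definition line y (t : R) : 'rV[R]_n.+1 := y + t *: delta_mx 0 0.

Lemma line0 y : line y 0 = y.
Proof. by rewrite /line scale0r addr0. Qed.

Lemma lineD y s t : line (line y s) t = line y (s + t).
Proof. by rewrite /line scalerDl addrA. Qed.

Lemma is_derive_line y t : 
  is_derive (t : R^o) 1 (line y : R^o -> 'rV[R]_n.+1) (delta_mx 0 0).
Proof.
have D : is_derive (t : R^o) 1 ((cst y : R^o -> 'rV[R]_n.+1) +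
    (fun u : R^o => u *: (delta_mx 0 0 : 'rV[R]_n.+1)))
    (0 + 1 *: (delta_mx 0 0 : 'rV[R]_n.+1)).
  apply: is_deriveD; split.
    by apply: diff_derivable; exact: ex_diff.
  by rewrite deriveE ?diff_val//; exact: ex_diff.
by apply: is_derive_eq D _; rewrite add0r scale1r.
Qed.

Lemma continuous_line y : continuous (line y).
Proof.
move=> t; apply: differentiable_continuous; apply/derivable1_diffP.
by have [] := is_derive_line y t.
Qed.

Lemma delta_mx_pt : delta_mx 0 0 = pt 1 0 :> 'rV[R]_n.+1.
Proof.
apply/rowP => i; rewrite /pt; case: (split_ordP (i : 'I_(1 + n))) => j ->.
  by rewrite (row_mxEl (const_mx 1 : 'rV_1)) !mxE (ord1 j).
by rewrite (row_mxEr (const_mx 1 : 'rV_1)) !mxE.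
Qed.

Lemma pt_line t u (s : 'rV[R]_n) : pt (t + u) s = line (pt t s) u.
Proof.
rewrite /line delta_mx_pt.
rewrite /pt; apply/rowP => i; case: (split_ordP (i : 'I_(1 + n))) => j ->.
  by rewrite !mxE !(unsplitK (inl j : 'I_1 + 'I_n)) !mxE mulr1.
by rewrite !mxE !(unsplitK (inr j : 'I_1 + 'I_n)) !mxE mulr0 addr0.
Qed.

Lemma pt_coord (y : 'rV[R]_n.+1) : pt (y 0 0) (rsubmx (y : 'rV[R]_(1 + n))) = y.
Proof.
rewrite /pt; apply/rowP => i; case: (split_ordP (i : 'I_(1 + n))) => j ->.
  rewrite mxE (unsplitK (inl j : 'I_1 + 'I_n)) mxE (ord1 j).
  by congr (y _ _); exact: val_inj.
by rewrite mxE (unsplitK (inr j : 'I_1 + 'I_n)) mxE.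
Qed.

Lemma pt_coord0 t (s : 'rV[R]_n) : pt t s 0 0 = t.
Proof.
have -> : (0 : 'I_n.+1) = lshift n (0 : 'I_1) by exact: val_inj.
by rewrite mxE (unsplitK (inl 0 : 'I_1 + 'I_n)) mxE.
Qed.

Lemma rsubmx_pt t (s : 'rV[R]_n) : rsubmx (pt t s : 'rV[R]_(1 + n)) = s.
Proof. exact: row_mxKr. Qed.

Lemma rsubmx_line y t :
  rsubmx (line y t : 'rV[R]_(1 + n)) = rsubmx (y : 'rV[R]_(1 + n)).
Proof. by rewrite -[y in LHS]pt_coord -pt_line rsubmx_pt. Qed.

Lemma line_coord0 y t : line y t 0 0 = y 0 0 + t.
Proof. by rewrite -[y in LHS]pt_coord -pt_line pt_coord0. Qed.

End Lines.

Lemma near_eq_continuous (T U : topologicalType) (f g : T -> U) (x : T) :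
  (\near x, f x = g x) -> {for x, continuous f} -> {for x, continuous g}.
Proof.
have fgx (fg : \near x, f x = g x) : f x = g x := nbhs_singleton fg.
move=> fg cf; rewrite /prop_for /continuous_at -fgx//.
by apply: cvg_trans cf; apply: near_eq_cvg; apply: filterS fg => y ->.
Qed.

Section Curves.
Context {R : realType} {n : nat} {M : topologicalType}.
Variable V : directed_volume_space R n M.
Implicit Types (c d : chart R n.+1 M) (J : set R) (gamma : R -> M).

(* Zorn's lemma on the extensions of [gamma]; these are only preordered, since
   the values of a curve outside its interval are junk. *)
Lemma integral_curve_maximal J gamma : integral_curve V J gamma -> J 0 ->
  exists J' gamma', [/\ maximal_integral_curve V (gamma 0) J' gamma',
    J `<=` J' & forall t, J t -> gamma' t = gamma t].
Proof.
move=> ig J0.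
pose T := {x : set R * (R -> M) | integral_curve V x.1 x.2 /\
  J `<=` x.1 /\ forall t, J t -> x.2 t = gamma t}.
pose x0 : T := exist _ (J, gamma) (conj ig (conj (fun t => id) (fun t _ => erefl))).
pose r (x y : T) := `[< (sval x).1 `<=` (sval y).1 /\
   forall t, (sval x).1 t -> (sval y).2 t = (sval x).2 t >].
have rr x : r x x by apply/asboolP; split.
have rt x y z : r x y -> r y z -> r x z.
  move=> /asboolP[xy xyE] /asboolP[yz yzE]; apply/asboolP; split.
    exact: subset_trans yz.
  by move=> t xt; rewrite yzE ?xyE//; exact: xy.
have [A totA|m maxm] := @ZL_preorder T x0 r rr rt.
- have [[a Aa]|A0] := pselect (exists a, A a); last first.
    by exists x0 => s As; exfalso; apply: A0; exists s.
  pose U := [set t | exists2 x, A x & (sval x).1 t].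
  (* The value at t is taken from an arbitrary member of the chain defined at t. The chain is
     totally ordered by extension, so all such members agree there. *)
  pose g t := if pselect (exists2 x, A x & (sval x).1 t) is left e
    then (sval (projT1 (cid2 e))).2 t else gamma t.
  have gE x t : A x -> (sval x).1 t -> g t = (sval x).2 t.
    move=> Ax xt; rewrite /g; case: pselect => [e|]; last by case; exists x.
    case: cid2 => /= y Ay yt.
    have [/asboolP[_ H]|/asboolP[_ H]] := totA _ _ Ax Ay; last by rewrite -H.
    by rewrite H.
  have oU : open U.
    rewrite openE => t [x Ax xt]; have [[ox _ _] _] := svalP x.
    by rewrite /interior; apply: filterS (open_nbhs_nbhs (conj ox xt)) => u xu; exists x.
  have near_g x t : A x -> (sval x).1 t -> \near t, (sval x).2 t = g t.
    move=> Ax xt; have [[ox _ _] _] := svalP x.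
    by apply: filterS (open_nbhs_nbhs (conj ox xt)) => u xu; rewrite (gE x).
  have iU : is_interval U.
    move=> s t [x Ax xs] [y Ay yt] u sut.
    have [[_ ix _] _] := svalP x; have [[_ iy _] _] := svalP y.
    have [/asboolP[xy _]|/asboolP[yx _]] := totA _ _ Ax Ay.
      by exists y => //; apply: (iy s t) => //; exact: xy.
    by exists x => //; apply: (ix s t) => //; exact: yx.
  have icU : integral_curve V U g.
    split => // t [x Ax xt]; have [[_ _ /(_ t xt)[cx dx]] _] := svalP x.
    have gx := near_g _ _ Ax xt.
    split; first exact: near_eq_continuous gx cx.
    move=> c Vc; rewrite (gE _ _ Ax xt) => ct.
    apply: near_eq_is_derive (dx _ Vc ct).
    by apply: filterS gx => u /= ->.
  have JU : J `<=` U.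
    by move=> t Jt; exists a => //; have [_ [+ _]] := svalP a; apply.
  have JE t : J t -> g t = gamma t.
    move=> Jt; have [_ [Ja JaE]] := svalP a.
    by rewrite (gE a) ?JaE//; exact: Ja.
  exists (exist _ (U, g) (conj icU (conj JU JE))) => x Ax.
  apply/asboolP; split=> /=; first by move=> t xt; exists x.
  by move=> t xt; exact: gE.
- have [im [Jm JmE]] := svalP m.
  exists (sval m).1, (sval m).2; split => //; split => //.
  + exact: Jm.
  + exact: JmE.
  + move=> J' g' ig' mJ' mE.
    have JJ' : J `<=` J' by exact: subset_trans mJ'.
    have JE t : J t -> g' t = gamma t.
      by move=> Jt; rewrite mE ?JmE//; exact: Jm.
    have := maxm (exist _ (J', g') (conj ig' (conj JJ' JE))).
    have rm : r m (exist _ (J', g') (conj ig' (conj JJ' JE))) by apply/asboolP.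
    by move=> /(_ rm) /asboolP[].
Qed.

End Curves.

Lemma is_derive_comp_diff (R : realType) (U W : normedModType R) (f : U -> W)
    (l : R^o -> U) (t : R^o) (v : U) :
  differentiable f (l t) -> is_derive t 1 l v ->
  is_derive t 1 (f \o l) ('d f (l t) v).
Proof.
move=> df [/derivable1_diffP dl lE].
have dfl : differentiable (f \o l) t by exact: differentiable_comp.
split; first exact/derivable1_diffP.
rewrite deriveE// diff_comp//=.
by have := deriveE (1 : R^o) dl; rewrite lE => <-.
Qed.

Section NormalCharts.
Context {R : realType} {n : nat} {M : topologicalType}.
Variable V : directed_volume_space R n M.
Implicit Types (c d : chart R n.+1 M) (J : set R) (gamma : R -> M) (x z : M).

Lemma transition_differentiable c d x : atlas V c -> atlas V d ->
  dom c x -> dom d x -> differentiable (transition c d) (to c x).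
Proof.
move=> Vc Vd cx dx; have [/(_ 1%N) [+ _] _] := atlas_compatible Vc Vd.
by apply; exists x.
Qed.

(** The fiber through z with its time shifted so that z sits at time 0, as [maximal_integral_curve]
    requires. This origin depends on z and not on the chart, so two charts can be compared. *)
Definition chart_times c z : set R := [set t | img c (line (to c z) t)].

Definition chart_curve c z (t : R) : M := from c (line (to c z) t).

Lemma chart_times0 c z : dom c z -> chart_times c z 0.
Proof. by move=> cz; rewrite /chart_times/= line0; exact: to_img. Qed.

Lemma chart_curve0 c z : dom c z -> chart_curve c z 0 = z.
Proof. by move=> cz; rewrite /chart_curve line0 toK. Qed.

Lemma chart_timesE c z t :
  chart_times c z t = fiber c (scoord c z) (tcoord c z + t).
Proof.
by rewrite /chart_times/fiber/= /tcoord /scoord pt_line pt_coord.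
Qed.

Lemma chart_times_open c z : open (chart_times c z).
Proof.
apply: (@open_comp _ _ (line (to c z)) (img c)) => [t _|].
  exact: continuous_line.
exact: img_open.
Qed.

Lemma chart_times_interval c z : saturated_normal_chart V c ->
  is_interval (chart_times c z).
Proof.
move=> [_ _ ic] s t; rewrite !chart_timesE => Js Jt u /andP[su ut].
by rewrite chart_timesE; apply: (ic _ _ _ Js Jt); rewrite !lerD2l su.
Qed.

(** In another chart d the line is its image under the transition, and the chain rule gives the
    velocity that [field_change] prescribes for the field in d. *)
Lemma chart_curve_integral c z : saturated_normal_chart V c ->
  integral_curve V (chart_times c z) (chart_curve c z).
Proof.
move=> sc; split; [exact: chart_times_open|exact: chart_times_interval|].
have [[Vc nc] _ _] := sc.
move=> t Jt; split.
  apply: (@continuous_comp _ _ _ (line (to c z)) (from c)).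
    exact: continuous_line.
  exact: from_continuous.
move=> d Vd dt; have ct : dom c (chart_curve c z t) by exact: from_dom.
rewrite (field_change Vc Vd ct dt) nc//.
have cE : to c (chart_curve c z t) = line (to c z) t by rewrite fromK.
have D := transition_differentiable Vc Vd ct dt.
rewrite cE in D *.
exact: is_derive_comp_diff D (is_derive_line _ _).
Qed.

(** Every entry of the curve in the coordinates of c has a constant derivative, so the mean value
    theorem determines it entry by entry. *)
Lemma integral_curve_line c J gamma t0 t : saturated_normal_chart V c ->
  integral_curve V J gamma -> J t0 -> J t -> (forall u, J u -> dom c (gamma u)) ->
  to c (gamma t) = line (to c (gamma t0)) (t - t0).
Proof.
move=> [[Vc nc] _ _] [_ iJ dJ] Jt0 Jt Jc.
have D u : J u -> is_derive (u : R^o) 1 (to c \o gamma : R^o -> 'rV[R]_n.+1)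
    (delta_mx 0 0).
  by move=> Ju; have [_ /(_ c Vc (Jc _ Ju))] := dJ _ Ju; rewrite nc//; exact: Jc.
apply/rowP => i; rewrite /line !mxE.
pose h (u : R^o) : R^o := to c (gamma u) 0 i.
pose e : R := (delta_mx 0 0 : 'rV[R]_n.+1) 0 i.
have Dh u : J u -> is_derive (u : R^o) 1 h e.
  move=> /D [D1 D2]; split.
    by have /derivable_mxP/(_ 0 i) := D1.
  by rewrite /e -D2 derive_mx// mxE.
have mvt a b : a <= b -> J a -> J b -> h b - h a = e * (b - a).
  move=> ab Ja Jb.
  have Jab u : a <= u <= b -> J u by exact: iJ.
  have [u| |u _ ->//] := @MVT_segment _ h (fun=> e) a b ab.
    rewrite in_itv/= => /andP[au ub]; apply: Dh; apply: Jab.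
    by rewrite !ltW.
  apply: for_continuous_within => u /Jab /Dh [Du _].
  exact/differentiable_continuous/derivable1_diffP.
suff : h t - h t0 = e * (t - t0).
  by rewrite /h /e !mxE mulrC => <-; rewrite addrC subrK.
have [t0t|tt0] := leP t0 t; first exact: mvt.
by apply: oppr_inj; rewrite opprB -mulrN opprB; apply: mvt => //; exact: ltW.
Qed.

(* Any extension of the curve has a maximal one, which stays in [dom c] by
   saturation, hence is a straight line there and cannot be longer. *)
Lemma chart_curve_maximal c z : saturated_normal_chart V c -> dom c z ->
  maximal_integral_curve V z (chart_times c z) (chart_curve c z).
Proof.
move=> sc cz; have ic := chart_curve_integral z sc.
have c0 := chart_times0 cz; have cc0 := chart_curve0 cz.
split => // J' gamma' ig' JJ' E'.
have J'0 := JJ' _ c0.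
have [J2 [gamma2 [max2 J'J2 E2]]] := integral_curve_maximal ig' J'0.
have [i2 J20 g20 _] := max2.
have [_ satc _] := sc.
have g'0 : gamma' 0 = z by rewrite E'// cc0.
have sub : gamma2 @` J2 `<=` dom c.
  by apply: satc max2; rewrite g'0.
have L u : J2 u -> to c (gamma2 u) = line (to c z) u.
  move=> J2u; rewrite (integral_curve_line sc i2 J20 J2u).
    by rewrite g20 g'0 subr0.
  by move=> v J2v; apply: sub; exists v.
move=> t /J'J2 J2t; rewrite /chart_times /= -L//; apply: to_img.
by apply: sub; exists t.
Qed.

Section TwoCharts.
Variables (c d : chart R n.+1 M) (z : M).
Hypotheses (sc : saturated_normal_chart V c) (sd : saturated_normal_chart V d).
Hypotheses (cz : dom c z) (dz : dom d z).

(** The line drawn in c is a maximal integral curve, so the saturation of the other domain captures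
    it as a whole. *)
Lemma chart_curve_dom t : chart_times c z t -> dom d (chart_curve c z t).
Proof.
move=> ct; have [_ + _] := sd.
by move=> /(_ z _ _ dz (chart_curve_maximal sc cz)); apply; exists t.
Qed.

Lemma transition_line t : chart_times c z t ->
  to d (chart_curve c z t) = line (to d z) t.
Proof.
move=> ct; have := integral_curve_line sd (chart_curve_integral z sc)
  (chart_times0 cz) ct chart_curve_dom.
by rewrite chart_curve0// subr0.
Qed.

Lemma chart_curveE t : chart_times c z t -> chart_curve c z t = chart_curve d z t.
Proof.
move=> ct; rewrite [RHS]/chart_curve -transition_line// toK//.
exact: chart_curve_dom.
Qed.

Lemma chart_times_sub : chart_times c z `<=` chart_times d z.
Proof.
move=> t ct; rewrite /chart_times/= -transition_line//; apply: to_img.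
exact: chart_curve_dom.
Qed.

End TwoCharts.

Lemma chart_times_eq c d z : saturated_normal_chart V c ->
  saturated_normal_chart V d -> dom c z -> dom d z ->
  chart_times c z = chart_times d z.
Proof.
by move=> sc sd cz dz; apply/seteqP; split; exact: chart_times_sub.
Qed.

End NormalCharts.

(** Both sides of the local identity are differentiated at y; a translation has the identity as its
    differential. *)
Lemma diff_translation (R : realType) (U W : normedModType R) (T : U -> W)
    (a y : U) (b : W) (v : U) :
  differentiable T (y + a) -> differentiable T y ->
  (\forall x \near y, T (x + a) = T x + b) ->
  'd T (y + a) v = 'd T y v.
Proof.
move=> dTa dT E.
have dsa : is_diff y (id + cst a : U -> U) (id + 0) by exact: is_diffD.
have dsb : is_diff (T y) (id + cst b : W -> W) (id + 0) by exact: is_diffD.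
have [da aE] := dsa; have [db bE] := dsb.
have D1 : differentiable (T \o (id + cst a)) y by exact: differentiable_comp.
have D2 : differentiable ((id + cst b) \o T) y by exact: differentiable_comp.
have e0 : 'D_v (T \o (id + cst a)) y = 'D_v ((id + cst b) \o T) y.
  exact: near_eq_derive v E.
have e1 : 'd (T \o (id + cst a)) y v = 'd T (y + a) v.
  rewrite (diff_comp da dTa) /=; congr ('d T _ _).
  by rewrite aE /= addr0.
have e2 : 'd ((id + cst b) \o T) y v = 'd T y v.
  by rewrite (diff_comp dT db) /= bE /= addr0.
have e3 := etrans (esym (deriveE v D1)) (etrans e0 (deriveE v D2)).
exact (etrans (esym e1) (etrans e3 e2)).
Qed.

(** * Densities of two normal charts along a common curve *)

Section TauChart.
Context {R : realType} {n : nat} {M : topologicalType}.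
Variable V : directed_volume_space R n M.
Implicit Types (c d : chart R n.+1 M).

(* A transition between normal charts commutes with the translations along the
   curves, so its Jacobian is constant along each of them. *)
Lemma transition_shift c d z t : saturated_normal_chart V c ->
  saturated_normal_chart V d -> dom c z -> dom d z -> chart_times c z t ->
  \forall y \near to c z,
    transition c d (line y t) = line (transition c d y) t.
Proof.
move=> sc sd cz dz ct.
have near1 : \forall y \near to c z, img c y.
  by apply: open_nbhs_nbhs; split; [exact: img_open|exact: to_img].
have near2 : \forall y \near to c z, img c (line y t).
  have cl : {for to c z, continuous (fun y : 'rV[R]_n.+1 => line y t)}.
    by apply: (@continuousD _ _ _ id (cst (t *: delta_mx 0 0)));
      [exact: cvg_id|exact: cst_continuous].
  have : nbhs (line (to c z) t) (img c).
    by apply: open_nbhs_nbhs; split; [exact: img_open|exact: ct].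
  exact: cl.
have near3 : \forall y \near to c z, dom d (from c y).
  apply: (from_continuous (to_img cz)); rewrite toK//.
  by apply: open_nbhs_nbhs; split; [exact: dom_open|exact: dz].
near=> y.
have cy : img c y by near: y.
have cyt : img c (line y t) by near: y.
have dy : dom d (from c y) by near: y.
have := @transition_line _ _ _ _ c d (from c y) sc sd (from_dom cy) dy t.
by rewrite /chart_times/= /chart_curve fromK//; apply.
Unshelve. all: by end_near. Qed.

Lemma jacobian_transition_line c d z t : saturated_normal_chart V c ->
  saturated_normal_chart V d -> dom c z -> dom d z -> chart_times c z t ->
  'J (transition c d) (line (to c z) t) = 'J (transition c d) (to c z).
Proof.
move=> sc sd cz dz ct.
suff dE v : 'd (transition c d) (line (to c z) t) v =
    'd (transition c d) (to c z) v.
  apply/matrixP => i j; rewrite /jacobian /lin1_mx [LHS]mxE [RHS]mxE.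
  exact: (congr1 (fun u : 'rV[R]_n.+1 => u 0 j) (dE _)).
have [[Vc _] _ _] := sc; have [[Vd _] _ _] := sd.
have dT := transition_differentiable Vc Vd cz dz.
have ctt : dom c (chart_curve c z t) by exact: from_dom.
have dTt := transition_differentiable Vc Vd ctt (chart_curve_dom sc sd cz dz ct).
have cE : to c (chart_curve c z t) = line (to c z) t by rewrite fromK.
rewrite cE in dTt.
exact: (diff_translation _ dTt dT (transition_shift sc sd cz dz ct)).
Qed.

(** By [density_change] the ratio of the densities is the Jacobian determinant of the transition. It
    is constant along the curve, and positive because the charts are oriented. *)
Lemma density_line c d z : saturated_normal_chart V c ->
  saturated_normal_chart V d -> dom c z -> dom d z ->
  exists2 k : R, 0 < k & forall t, chart_times c z t ->
    density V c (chart_curve c z t) = density V d (chart_curve d z t) * k.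
Proof.
move=> sc sd cz dz; have [[Vc _] _ _] := sc; have [[Vd _] _ _] := sd.
exists (\det ('J (transition c d) (to c z))).
  by have [_ ->] := atlas_compatible Vc Vd.
move=> t ct; have ctt : dom c (chart_curve c z t) by exact: from_dom.
rewrite (density_change Vc Vd ctt (chart_curve_dom sc sd cz dz ct)).
have cE : to c (chart_curve c z t) = line (to c z) t by rewrite fromK.
rewrite cE (jacobian_transition_line sc sd cz dz ct).
by rewrite (chart_curveE sc sd cz dz ct).
Qed.

End TauChart.

(** * Independence of tau from the chart *)

Section Translation.
Context {R : realType}.
Local Notation mu := (@lebesgue_measure R).

Let tr (a : R) : measurableTypeR R -> measurableTypeR R := fun u => a + u.

Let measurable_tr a : measurable_fun [set: measurableTypeR R] (tr a).
Proof. by apply: measurable_funD => //; exact: measurable_cst. Qed.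

HB.instance Definition _ a := isMeasurableFun.Build _ _ _ _ (tr a) (measurable_tr a).

(** Lebesgue measure is determined by its values on half-open intervals, where the claim is a
    computation of lengths. *)
Lemma lebesgue_measure_translation (a : R) (A : set (measurableTypeR R)) :
  measurable A -> pushforward mu (tr a) A = mu A.
Proof.
move=> mA; apply/esym/lebesgue_measure_unique => //= _ [[x y]] _ <-.
rewrite /pushforward.
have -> : tr a @^-1` [set` `]x, y] ] = [set` `](x - a), (y - a)]].
  by apply/seteqP; split => u; rewrite /= !in_itv/= /tr ltrBlDl lerBrDl.
rewrite !lebesgue_measure_itv/= !lte_fin ltrD2r -!EFinD.
by case: ifP => // _; congr EFin; ring.
Qed.

Lemma ge0_integral_translation (a : R) (D : set R) (f : R -> \bar R) :
  measurable (D : set (measurableTypeR R)) ->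
  measurable_fun (D : set (measurableTypeR R)) f ->
  (forall t, D t -> 0 <= f t)%E ->
  (\int[mu]_(t in D) f t = \int[mu]_(t in [set u | D (a + u)%R]) f (a + t)%R)%E.
Proof.
move=> mD mf f0.
rewrite -(@ge0_integral_pushforward _ _ _ _ R (tr a) (measurable_tr a) mu D f)//; last first.
  by move=> t; rewrite inE; exact: f0.
by apply: eq_measure_integral => A mA _; exact/esym/lebesgue_measure_translation.
Qed.

Section BoundaryIntegral.
Variables (J : set R) (f : R -> R).
Hypotheses (mJ : measurable (J : set (measurableTypeR R))).
Hypothesis mf : measurable_fun J f.
Hypothesis f0 : forall t, 0 <= f t.

Let mfS (A : set (measurableTypeR R)) : measurable A ->
  measurable_fun (J `&` A) (EFin \o f).
Proof.
by move=> mA; apply/measurable_EFinP; apply: measurable_funS mf.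
Qed.

Lemma boundary_integral_translation a t :
  boundary_integral [set u | J (a + u)] (fun u => f (a + u)) t =
  boundary_integral J f (a + t).
Proof.
have tr_cut (I : interval R) (I' : interval R) :
    (forall u, (u \in I') = (a + u \in I)) ->
    (\int[mu]_(u in [set u | J (a + u)%R] `&` [set` I']) (f (a + u))%:E =
     \int[mu]_(u in J `&` [set` I]) (f u)%:E)%E.
  move=> II'; rewrite (ge0_integral_translation a (D := J `&` [set` I])).
  - by congr (integral _ _ _); apply/seteqP; split => u; rewrite /= II'.
  - exact: measurableI.
  - exact: mfS.
  - by move=> u _; rewrite lee_fin.
rewrite /boundary_integral; congr Order.min; apply: tr_cut => u.
  by rewrite !in_itv/= lerD2l.
by rewrite !in_itv/= !andbT lerD2l.
Qed.

Lemma boundary_integralZ k t : 0 <= k ->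
  boundary_integral J (fun u => k * f u) t = (k%:E * boundary_integral J f t)%E.
Proof.
move=> k0; rewrite /boundary_integral mine_pMr ?lee_fin//.
congr Order.min.
- under eq_integral do rewrite EFinM.
  by rewrite ge0_integralZl//; [exact: measurableI|exact: mfS|move=> *; rewrite lee_fin].
- under eq_integral do rewrite EFinM.
  by rewrite ge0_integralZl//; [exact: measurableI|exact: mfS|move=> *; rewrite lee_fin].
Qed.

Lemma eq_boundary_integral h t : (forall u, J u -> f u = h u) ->
  boundary_integral J f t = boundary_integral J h t.
Proof.
move=> fh; rewrite /boundary_integral.
by congr Order.min; apply: eq_integral => u; rewrite inE => -[Ju _]; rewrite fh.
Qed.

End BoundaryIntegral.
End Translation.

(** For infinite x both sides are 0: a factor k > 0 keeps x infinite, and [fine] sends it to 0. So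
    the scaling leaves [fine] even if the boundary integral diverges. *)
Lemma fineZ (R : realType) (k : R) (x : \bar R) : 0 < k ->
  fine (k%:E * x) = k * fine x.
Proof.
move=> k0; case: x => [r| |] //=.
  by rewrite gt0_muley ?lte_fin// mulr0.
by rewrite gt0_muleNy ?lte_fin// mulr0.
Qed.

Section TauChart.
Context {R : realType} {n : nat} {M : topologicalType}.
Variable V : directed_volume_space R n M.
Implicit Types (c d : chart R n.+1 M) (s : 'rV[R]_n).

Lemma ptE t s : pt t s = line (pt 0 s) t.
Proof. by rewrite -pt_line add0r. Qed.

Lemma density_continuous c y : atlas V c -> img c y ->
  {for y, continuous (fun y => density V c (from c y))}.
Proof.
move=> Vc cy; have [H _] := density_smooth Vc 1%N.
exact: differentiable_continuous (H _ cy).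
Qed.

Lemma Omega_continuous c s t : atlas V c -> fiber c s t ->
  {for t, continuous (fun t => Omega V c t s)}.
Proof.
move=> Vc ct.
have E : (fun t => Omega V c t s) =
    (fun y => density V c (from c y)) \o line (pt 0 s).
  by apply/funext => u; rewrite /Omega ptE.
rewrite E; apply: continuous_comp; first exact: continuous_line.
by apply: density_continuous => //; rewrite -ptE.
Qed.

Lemma Omega_gt0 c s t : atlas V c -> fiber c s t -> 0 < Omega V c t s.
Proof. by move=> Vc ct; apply: density_gt0 => //; exact: from_dom. Qed.

Lemma fiber_open c s : open (fiber c s).
Proof.
have -> : fiber c s = line (pt 0 s) @^-1` img c.
  by apply/funext => t; rewrite /fiber/= ptE.
apply: (@open_comp _ _ (line (pt 0 s)) (img c)) => [t _|].
  exact: continuous_line.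
exact: img_open.
Qed.

(** Two normal charts may place the time origin of a curve differently. Measured from z, the
    integrals of both charts run over the same set of times, by [chart_times_eq]. *)
Lemma chart_boundary_integralE p c z : saturated_normal_chart V c -> dom c z ->
  chart_boundary_integral V p c z =
  boundary_integral (chart_times c z)
    (fun u => density V c (chart_curve c z u) `^ (- (p - 1)^-1)) 0.
Proof.
move=> [[Vc _] _ ic] cz; set a := tcoord c z; set s := scoord c z.
rewrite /chart_boundary_integral -/a -/s -{1}[a]addr0.
rewrite -(@boundary_integral_translation _ (fiber c s)).
- have -> : chart_times c z = [set u | fiber c s (a + u)].
    by apply/funext => u; rewrite chart_timesE.
  have -> // : (fun u => density V c (chart_curve c z u) `^ (- (p - 1)^-1)) =
      (fun u => Omega V c (a + u) s `^ (- (p - 1)^-1)).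
  by apply/funext => u; rewrite /Omega pt_line pt_coord.
- exact: is_interval_measurable.
- apply: measurable_fun_continuous_open; first exact: fiber_open.
  move=> t ct; apply: (@continuous_comp _ _ _ (fun t => Omega V c t s)
    (fun y => y `^ _)); first exact: Omega_continuous.
  by apply: continuous_powR_gt0; exact: Omega_gt0.
- by move=> t; exact: powR_ge0.
Qed.

Lemma chart_tauE p c z : dom c z ->
  chart_tau V p c z =
  density V c z `^ (p - 1)^-1 * fine (chart_boundary_integral V p c z).
Proof. by move=> cz; rewrite /chart_tau /Omega pt_coord toK. Qed.

(* Along a common integral curve the two densities differ by a constant factor
   [k], which cancels between the two occurrences of Omega in tau. *)
Lemma chart_tau_indep p c d z : saturated_normal_chart V c ->
  saturated_normal_chart V d -> dom c z -> dom d z ->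
  chart_tau V p c z = chart_tau V p d z.
Proof.
move=> sc sd cz dz; rewrite (chart_tauE p cz) (chart_tauE p dz).
rewrite (chart_boundary_integralE p sc cz) (chart_boundary_integralE p sd dz).
have [[Vc _] _ _] := sc; have [[Vd _] _ _] := sd.
have [k k0 kE] := density_line sc sd cz dz.
rewrite -(chart_times_eq sc sd cz dz).
set r := (p - 1)^-1.
have dE u : chart_times c z u -> 0 < density V d (chart_curve d z u).
  move=> cu; apply: density_gt0 => //; apply: from_dom.
  by have := chart_times_eq sc sd cz dz; rewrite /chart_times => H;
    have := cu; rewrite /chart_times H.
have E u : chart_times c z u ->
    density V c (chart_curve c z u) `^ (- r) =
    k `^ (- r) * density V d (chart_curve d z u) `^ (- r).
  by move=> cu; rewrite kE// powRM ?(ltW k0) ?ltW ?dE// mulrC.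
rewrite (eq_boundary_integral _ E).
have mJ : measurable (chart_times c z : set (measurableTypeR R)).
  by apply: is_interval_measurable; exact: (chart_times_interval sc).
have mD : measurable_fun (chart_times c z)
    (fun u => density V d (chart_curve d z u) `^ (- r)).
  rewrite (chart_times_eq sc sd cz dz).
  apply: measurable_fun_continuous_open; first exact: chart_times_open.
  move=> t ct; apply: (@continuous_comp _ _ _
    (fun t => density V d (chart_curve d z t)) (fun y => y `^ _)).
    apply: (@continuous_comp _ _ _ (line (to d z))
      (fun y => density V d (from d y))); first exact: continuous_line.
    exact: density_continuous.
  by apply: continuous_powR_gt0; apply: density_gt0 => //; exact: from_dom.
rewrite (boundary_integralZ mJ mD) ?powR_ge0//; last first.
  by move=> u; exact: powR_ge0.
have := kE 0 (chart_times0 cz); rewrite (chart_curve0 cz) (chart_curve0 dz) => ->.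
rewrite powRM ?(ltW k0) ?(ltW (density_gt0 _ _))//.
rewrite fineZ ?powR_gt0//.
have kk : k `^ r * k `^ (- r) = 1.
  by rewrite -powRD ?subrr ?powRr0// (gt_eqF k0) implybT.
by rewrite mulrA -(mulrA _ (k `^ r)) kk mulr1.
Qed.

Lemma tauE p c z : traceable_chart V p c -> dom c z -> tau V p z = chart_tau V p c z.
Proof.
move=> tc cz; rewrite /tau; case: pselect => [e|]; last by case; exists c.
case: cid => /= d [[sd _] dz]; have [sc _] := tc.
exact: chart_tau_indep.
Qed.

End TauChart.

(** * Properness of the integral curves *)

Section CompactSupport.
Context {R : realType} {n : nat} {M : topologicalType}.
Variable V : directed_volume_space R n M.
Implicit Types (c d : chart R n.+1 M) (s : 'rV[R]_n) (x z : M).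

Lemma chart_timesD c z t0 t : chart_times c z t0 ->
  chart_times c (chart_curve c z t0) t = chart_times c z (t0 + t).
Proof. by move=> ct0; rewrite /chart_times/= /chart_curve fromK// lineD. Qed.

Lemma chart_curveD c z t0 t : chart_times c z t0 ->
  chart_curve c (chart_curve c z t0) t = chart_curve c z (t0 + t).
Proof. by move=> ct0; rewrite {1}/chart_curve [in line _ _]fromK// lineD. Qed.

Lemma open_scoord_neq s :
  open [set y : 'rV[R]_n.+1 | rsubmx (y : 'rV[R]_(1 + n)) != s].
Proof.
rewrite openE => y /= ys.
have [i si] : exists i, rsubmx (y : 'rV[R]_(1 + n)) 0 i != s 0 i.
  apply/existsP; rewrite -negb_forall; apply: contra ys => /forallP H.
  by apply/eqP/rowP => i; exact/eqP.
pose i' : 'I_n.+1 := rshift 1 i.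
have : nbhs y [set y' : 'rV[R]_n.+1 | y' 0 i' != s 0 i].
  rewrite mxE in si.
  have cc := @coord_continuous R 1 n.+1 0 i' y.
  have : nbhs (y 0 i') [set r : R | r != s 0 i].
    by apply: open_nbhs_nbhs; split => //; exact: open_neq.
  exact: cc.
apply: filterS => y' /= y'i; apply: contra y'i => /eqP/rowP/(_ i).
by rewrite mxE => ->.
Qed.

(* In a chart [d] around a point [x] the curve is a single segment s = const, so
   it is near [x] only during a bounded interval of times. *)
Lemma chart_curve_locally_bounded c z d x : saturated_normal_chart V c ->
  dom c z -> saturated_normal_chart V d -> dom d x ->
  exists a b, [/\ chart_times c z a, chart_times c z b &
    \forall y \near x, forall t, chart_times c z t -> chart_curve c z t = y ->
      a <= t <= b].
Proof.
move=> sc cz sd dx.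
have c0 := chart_times0 cz.
have near_d : \forall y \near x, dom d y.
  by apply: open_nbhs_nbhs; split; [exact: dom_open|].
have near_to (P : set 'rV[R]_n.+1) : open P -> P (to d x) ->
    \forall y \near x, dom d y /\ P (to d y).
  move=> oP Px; have : nbhs (to d x) P by exact: open_nbhs_nbhs.
  by move=> /(to_continuous dx); apply: filterS2 near_d => y.
have [[t0 ct0 dt0]|] := pselect (exists2 t, chart_times c z t &
    dom d (chart_curve c z t)); last first.
  (* The curve never enters [dom d], so the bound holds vacuously near x; 0 is used because it is a
     time of the curve. *)
  move=> H; exists 0, 0; split => //.
  by apply: filterS near_d => y dy t ct ty; exfalso; apply: H; exists t => //; rewrite ty.
set z' := chart_curve c z t0.
have cz' : dom c z' by exact: from_dom.
have cd : chart_times c z' = chart_times d z' by exact: chart_times_eq sc sd cz' dt0.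
have curveE t : chart_times c z t -> to d (chart_curve c z t) = line (to d z') (t - t0).
  move=> ct; have ct' : chart_times c z' (t - t0) by rewrite chart_timesD// subrKC.
  rewrite -(transition_line sc sd cz' dt0 ct') chart_curveD//.
  by rewrite subrKC.
have [sx|sx] := eqVneq (scoord d x) (scoord d z'); last first.
  (* Inside [dom d] the curve keeps the coordinate s of z', so it avoids the open set of points that
     have another s; this set contains x. *)
  exists 0, 0; split => //.
  have := near_to _ (@open_scoord_neq _) sx.
  apply: filterS => y [dy ys] t ct ty; exfalso; move: ys.
  by rewrite /= -ty curveE// rsubmx_line /scoord eqxx.
(* Here x lies on the fiber of z', hence on the curve itself; u0 is the travel time from z' to x. *)
pose u0 := tcoord d x - tcoord d z'.
have du0 : chart_times d z' u0.
  have dxE : line (to d z') u0 = to d x.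
    rewrite -[to d z']pt_coord -[RHS]pt_coord -pt_line; congr pt.
      by rewrite /u0 /tcoord subrKC.
    by rewrite -/(scoord d z') -/(scoord d x) sx.
  by rewrite /chart_times/= dxE; exact: to_img.
have [a [b [da db au ub]]] := open_margin (@chart_times_open _ _ _ d z') du0.
exists (t0 + a), (t0 + b); rewrite -!chart_timesD// -/z' cd; split => //.
have oP : open [set y : 'rV[R]_n.+1 | a < y 0 0 - tcoord d z' < b].
  have -> : [set y : 'rV[R]_n.+1 | a < y 0 0 - tcoord d z' < b] =
      (fun y : 'rV[R]_n.+1 => y 0 0) @^-1` `](a + tcoord d z'), (b + tcoord d z')[.
    by apply/seteqP; split => y /=; rewrite in_itv/= ltrBrDr ltrBlDr.
  apply: open_comp => [y _|]; first exact: coord_continuous.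
  exact: interval_open.
have /near_to : [set y : 'rV[R]_n.+1 | a < y 0 0 - tcoord d z' < b] (to d x).
  by rewrite /= au.
move=> /(_ oP); apply: filterS => y [dy /= yab] t ct ty.
move: yab; rewrite -ty curveE// line_coord0 /tcoord addrAC subrr add0r.
by rewrite ltrBrDl ltrBlDl => /andP[/ltW-> /ltW->].
Qed.

(** Each point of K has a neighbourhood that the curve visits only between two of its times, and
    compactness makes the bound uniform. The near-covering form of compactness is applied to the
    filter of pairs of times, directed by widening the segment between them. *)
Lemma chart_curve_proper c z (K : set M) : saturated_normal_chart V c ->
  dom c z -> (forall x, exists2 d, saturated_normal_chart V d & dom d x) ->
  compact K ->
  exists a b, [/\ chart_times c z a, chart_times c z b &
    forall t, chart_times c z t -> K (chart_curve c z t) -> a <= t <= b].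
Proof.
move=> sc cz cover /compact_near_coveringP cK.
pose D := [set ab : R * R | chart_times c z ab.1 /\ chart_times c z ab.2].
pose B (ab : R * R) := [set ab' : R * R | D ab' /\ (ab'.1 <= ab.1 /\ ab.2 <= ab'.2)].
have c0 := chart_times0 cz.
have FF : Filter (filter_from D B).
  apply: filter_from_filter; first by exists (0, 0).
  move=> [a b] [a' b'] [/= ca cb] [/= ca' cb'].
  exists (Num.min a a', Num.max b b').
    by split => /=; [case: (leP a a')|case: (leP b b')].
  move=> [x y] [Dxy [/=]]; rewrite le_min ge_max => /andP[xa xa'] /andP[yb yb'].
  by split; split.
pose P (ab : R * R) y := forall t, chart_times c z t -> chart_curve c z t = y ->
  ab.1 <= t <= ab.2.
have := cK (R * R)%type (filter_from D B) P FF.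
case=> [x _|[a b] [/= ca cb] H].
  have [d sd dx] := cover x.
  have [a [b [ca cb nx]]] := chart_curve_locally_bounded sc cz sd dx.
  exists ([set y | P (a, b) y], B (a, b)) => /=.
    by split; [exact: nx|exists (a, b)].
  move=> [y [a' b']] [/= Py [_ [/= aa bb]]] t ct ty.
  by have /andP[? ?] := Py t ct ty; rewrite (le_trans aa)//= (le_trans _ bb).
exists a, b; split => // t ct Kt.
by have := H (a, b) (conj (conj ca cb) (conj (lexx a) (lexx b))) _ Kt t ct erefl.
Qed.

End CompactSupport.

(** * The derivative along X in a normal chart *)

Section DirectionalDerivative.
Context {R : realType} {n : nat} {M : topologicalType}.
Variable V : directed_volume_space R n M.
Implicit Types (c d : chart R n.+1 M) (s : 'rV[R]_n) (x z : M).
Variable phi : M -> R.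
Hypothesis phi1 : forall c, atlas V c -> Ck 1 (img c) (phi \o from c : 'rV[R]_n.+1 -> R^o).

Let inchart c : 'rV[R]_n.+1 -> R^o := phi \o from c.

Let inchart_diff c y : atlas V c -> img c y -> differentiable (inchart c) y.
Proof. by move=> Vc; have [H _] := phi1 Vc; exact: H. Qed.

(** Near x the function seen in the chosen chart d is the function seen in c after the transition,
    and [field_change] moves the field by the differential of that same transition. The chain rule
    does the rest. *)
Lemma XderiveE c x : atlas V c -> dom c x ->
  Xderive V phi x = 'd (phi \o from c : 'rV[R]_n.+1 -> R^o) (to c x) (vfield V c x).
Proof.
move=> Vc cx; rewrite /Xderive.
have [Vd dx] : atlas V (chart_at V x) /\ dom (chart_at V x) x.
  exact: projT2 (cid (atlas_cover V x)).
set d := chart_at V x in Vd dx *.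
rewrite (field_change Vd Vc dx cx).
have dT := transition_differentiable Vd Vc dx cx.
have TE : transition d c (to d x) = to c x by rewrite /transition/= toK.
have dF : differentiable (inchart c) (transition d c (to d x)).
  by rewrite TE; apply: inchart_diff => //; exact: to_img.
have near_eq : \forall y \near to d x, inchart d y = (inchart c \o transition d c) y.
  have near1 : \forall y \near to d x, dom c (from d y).
    apply: (from_continuous (to_img dx)); rewrite toK//.
    by apply: open_nbhs_nbhs; split; [exact: dom_open|exact: cx].
  by apply: filterS near1 => y cy; rewrite /inchart /transition /= toK.
have dFT : differentiable (inchart c \o transition d c) (to d x).
  exact: differentiable_comp.
have e1 := near_eq_derive (vfield V d x) near_eq.
have e2 := deriveE (vfield V d x) dFT.
have e3 := congr1 (fun f : 'rV[R]_n.+1 -> R^o => f (vfield V d x)) (diff_comp dT dF).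
have e4 := etrans e1 (etrans e2 e3).
by move: e4; rewrite /= TE.
Qed.

Lemma Xderive_normal c y : normal_chart V c -> img c y ->
  Xderive V phi (from c y) =
  'd (phi \o from c : 'rV[R]_n.+1 -> R^o) y (delta_mx 0 0).
Proof.
move=> [Vc nc] cy; have cf : dom c (from c y) by exact: from_dom.
have E := XderiveE Vc cf; rewrite (nc _ cf) in E.
have yE := fromK cy; rewrite yE in E; exact E.
Qed.

(** [Ck] provides continuity of the differential on a fixed vector; in a normal chart the field is
    such a fixed vector. *)
Lemma Xderive_chart_continuous c y : normal_chart V c -> img c y ->
  {for y, continuous (fun y => Xderive V phi (from c y))}.
Proof.
move=> nc cy; have [Vc _] := nc.
have [_ /(_ (delta_mx 0 0) y cy) H] := phi1 Vc.
apply: near_eq_continuous H.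
have : nbhs y (img c) by apply: open_nbhs_nbhs; split => //; exact: img_open.
by apply: filterS => y' cy'; rewrite Xderive_normal.
Qed.

Lemma is_derive_fiber c s t : normal_chart V c -> fiber c s t ->
  is_derive t 1 (fun t => phi (from c (pt t s))) (Xderive V phi (from c (pt t s))).
Proof.
move=> nc ct; have [Vc _] := nc.
rewrite (Xderive_normal nc ct).
have E : (fun t => phi (from c (pt t s))) = inchart c \o line (pt 0 s).
  by apply/funext => u; rewrite /inchart /= -ptE.
have cl : img c (line (pt 0 s) t) by rewrite -ptE.
rewrite E (ptE t s).
exact: (is_derive_comp_diff (inchart_diff Vc cl) (is_derive_line (pt 0 s) t)).
Qed.

Lemma Xderive_fiber_continuous c s t : normal_chart V c -> fiber c s t ->
  {for t, continuous (fun t => Xderive V phi (from c (pt t s)))}.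
Proof.
move=> nc ct.
have E : (fun t => Xderive V phi (from c (pt t s))) =
    (fun y => Xderive V phi (from c y)) \o line (pt 0 s).
  by apply/funext => u; rewrite /= -ptE.
rewrite E; apply: continuous_comp; first exact: continuous_line.
by apply: Xderive_chart_continuous => //; rewrite -ptE.
Qed.

End DirectionalDerivative.

(** * Hardy inequality on the fibers of a traceable chart *)

Section HardyChart.
Context {R : realType} {n : nat} {M : topologicalType}.
Variable V : directed_volume_space R n M.
Variables (p : R) (phi : M -> R).
Hypotheses (p1 : 1 < p) (tr : traceable V p) (phi1 : C1c V phi).

Lemma hardy_chart (c : chart R n.+1 M) (s : 'rV[R]_n) (h : M -> R) :
  traceable_chart V p c -> (forall x, 0 <= h x) ->
  (forall x, h x <= `|phi x| `^ p / tau V p x `^ p) ->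
  measurable_fun (fiber c s) (fun t => h (from c (pt t s))) ->
  (\int[@lebesgue_measure R]_(t in fiber c s)
     (h (from c (pt t s)) * Omega V c t s)%:E <=
   ((p / (p - 1)) `^ p)%:E * \int[@lebesgue_measure R]_(t in fiber c s)
     (`|Xderive V phi (from c (pt t s))| `^ p * Omega V c t s)%:E)%E.
Proof.
move=> tc h0 hle mh; have [sc fin] := tc.
have [nc _ ic] := sc; have [Vc _] := nc.
have [phiC cK] := phi1.
have [[t0 ct0]|F0] := pselect (exists t, fiber c s t); last first.
  have -> : fiber c s = set0.
    by apply/seteqP; split => // t ct; apply: F0; exists t.
  by rewrite !integral_set0 mule0.
(* Any point of the fiber serves as the origin of time. Times counted from z are those of the fiber
   shifted by t0, which is why the support is bounded by t0 + a and t0 + b. *)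
pose z := from c (pt t0 s).
have cz : dom c z by exact: from_dom.
have zE : to c z = pt t0 s by rewrite fromK.
have timesE t : chart_times c z t = fiber c s (t0 + t).
  by rewrite /chart_times /fiber /= zE pt_line.
have curveE t : chart_curve c z t = from c (pt (t0 + t) s).
  by rewrite /chart_curve zE pt_line.
have cover x : exists2 d, saturated_normal_chart V d & dom d x.
  by have [d [[sd _] dx]] := tr x; exists d.
have [a [b [ca cb Hab]]] := chart_curve_proper sc cz cover cK.
rewrite !timesE in ca cb.
have Om t : fiber c s t -> 0 < Omega V c t s by exact: Omega_gt0.
have cO t : fiber c s t -> {for t, continuous (fun t => Omega V c t s)}.
  exact: Omega_continuous.
have fs t : fiber c s t -> scoord c (from c (pt t s)) = s /\
    tcoord c (from c (pt t s)) = t.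
  by move=> ct; rewrite /scoord /tcoord fromK// rsubmx_pt pt_coord0.
have mO : measurable_fun (fiber c s) (fun t => Omega V c t s).
  by apply: measurable_fun_continuous_open => //; exact: fiber_open.
(* Off the fiber [Omega] is a junk value of unknown sign, whereas [hardy_fiber] asks for
   nonnegativity everywhere; hence the default 0. *)
pose k t := if asbool (fiber c s t) then h (from c (pt t s)) * Omega V c t s else 0.
have kE t : fiber c s t -> k t = h (from c (pt t s)) * Omega V c t s.
  by move=> ct; rewrite /k asboolT.
have -> : (\int[@lebesgue_measure R]_(t in fiber c s)
     (h (from c (pt t s)) * Omega V c t s)%:E =
   \int[@lebesgue_measure R]_(t in fiber c s) (k t)%:E)%E.
  by apply: eq_integral => t; rewrite inE => ct; rewrite kE.
apply: (@hardy_fiber _ p (fiber c s) (fun t => Omega V c t s)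
  (fun t => phi (from c (pt t s))) (fun t => Xderive V phi (from c (pt t s))) k
  p1 (@fiber_open _ _ _ _ _) (ic s) Om cO _ _ _ _ _ _ (t0 + a) (t0 + b) _ ca cb).
- move=> t ct; have := fin _ (from_dom ct).
  by rewrite /chart_boundary_integral; have [-> ->] := fs _ ct.
- by move=> t ct; exact: is_derive_fiber.
- by move=> t ct; exact: Xderive_fiber_continuous.
- apply: (@eq_measurable_fun _ _ _ _ _
    (fun t => h (from c (pt t s)) * Omega V c t s)).
    by move=> t; rewrite inE => ct; rewrite kE.
  exact: measurable_funM.
- move=> t; rewrite /k; case: asboolP => // ct.
  by rewrite mulr_ge0// ltW// Om.
- move=> t ct; rewrite kE// ler_wpM2r ?(ltW (Om _ ct))//.
  apply: le_trans (hle _) _; rewrite (tauE tc (from_dom ct)) /chart_tau.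
  by rewrite /chart_boundary_integral; have [-> ->] := fs _ ct.
- move=> t ct /negP tab; apply/eqP/negPn/negP => phit; apply: tab.
  have ct' : chart_times c z (t - t0) by rewrite timesE subrKC.
  have := Hab _ ct'; rewrite curveE subrKC.
  have Kt : closure [set x | phi x != 0] (from c (pt t s)).
    by apply: subset_closure.
  by move=> /(_ Kt); rewrite lerBrDl lerBlDl.
Qed.

End HardyChart.

(** * The volume measure in a chart *)

Section DensityChangeOfVariables.
Local Open Scope ereal_scope.
Context d1 d2 (X : measurableType d1) (Y : measurableType d2) (R : realType).
Variables (nu : {measure set X -> \bar R}) (mu : {measure set Y -> \bar R}).
Variables (D : set X) (A : set Y) (phi : X -> Y) (w : X -> R).
Hypotheses (mD : measurable D) (mA : measurable A).
Hypothesis mphi : measurable_fun D phi.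
Hypothesis mw : measurable_fun D w.
Hypothesis w0 : forall x, D x -> (0 <= w x)%R.
Hypothesis DA : forall x, D x -> A (phi x).
Hypothesis muE : forall B, measurable B -> B `<=` A ->
  mu B = \int[nu]_(x in D `&` phi @^-1` B) (w x)%:E.

Import HBNNSimple.

Let mpre B : measurable B -> measurable (D `&` phi @^-1` B).
Proof. exact: mphi. Qed.

Let mind (B : set Y) : measurable B ->
  measurable_fun D (fun x => (\1_B (phi x) : R)%R).
Proof.
move=> mB; apply: (@measurableT_comp _ _ _ _ _ _ (\1_B : Y -> R)) mphi.
exact: measurable_indic.
Qed.

Let w0E x : D x -> 0 <= (w x)%:E.
Proof. by move=> Dx; rewrite lee_fin w0. Qed.

Let integral_density_indic (B : set Y) (r : R) : measurable B -> (0 <= r)%R ->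
  \int[nu]_(x in D) ((w x)%:E * (r * \1_B (phi x))%:E) = r%:E * mu (A `&` B).
Proof.
move=> mB r0; rewrite muE; last 2 first.
- exact: measurableI.
- exact: subIsetl.
have -> : D `&` phi @^-1` (A `&` B) = D `&` (D `&` phi @^-1` B).
  apply/seteqP; split => x /= [Dx]; first by case.
  by move=> [_ Bx]; split => //; split => //; exact: DA.
rewrite integral_mkcondr -ge0_integralZl//.
- apply: eq_integral => x; rewrite inE => Dx; rewrite patchE indicE.
  have -> : (x \in D `&` phi @^-1` B) = (phi x \in B).
    by apply/idP/idP; rewrite !inE//; case.
  case: (phi x \in B); last by rewrite mulr0 !mule0.
  by rewrite mulr1 [LHS]muleC.
- apply/(measurable_restrict _ _ _).1 => //.
    exact: mpre.
  rewrite setIA setIid; apply/measurable_EFinP; apply: measurable_funS mw => //.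
- by move=> x Dx; rewrite patchE; case: ifPn => // _; exact: w0E.
Qed.

Let integral_nnsfun (g : {nnsfun Y >-> R}) :
  \int[mu]_(y in A) (g y)%:E = \int[nu]_(x in D) ((w x)%:E * (g (phi x))%:E).
Proof.
under eq_integral do rewrite fimfunE -fsumEFin//.
rewrite ge0_integral_fsum//; last 2 first.
- by move=> r; exact/measurable_EFinP/measurable_funM.
- by move=> r y _; rewrite nnfun_muleindic_ge0.
have E x : (w x)%:E * (g (phi x))%:E = \sum_(r \in range g)
    (w x)%:E * (r * \1_(g @^-1` [set r]) (phi x))%:E.
  rewrite fimfunE -fsumEFin// ge0_mule_fsumr//.
  by move=> r; rewrite nnfun_muleindic_ge0.
under [RHS]eq_integral do rewrite E.
rewrite ge0_integral_fsum//; last 2 first.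
- move=> r; apply: emeasurable_funM; first exact/measurable_EFinP.
  by apply/measurable_EFinP/measurable_funM => //; exact: mind.
- move=> r x Dx; rewrite mule_ge0 ?w0E//.
  exact: nnfun_muleindic_ge0.
apply: eq_fsbigr => r; rewrite inE => -[y _ <-].
rewrite integral_density_indic//.
rewrite integralZl_indic_nnsfun// integral_indic//.
by rewrite setIC.
Qed.

(** [muE] says that on A the measure mu is the image under phi of w times nu, which is the claim for
    indicators. Linearity gives simple functions, and monotone convergence the general case. *)
Lemma ge0_integral_density (f : Y -> \bar R) : measurable_fun A f ->
  (forall y, A y -> 0 <= f y) ->
  \int[mu]_(y in A) f y = \int[nu]_(x in D) ((w x)%:E * f (phi x)).
Proof.
move=> mf f0; pose f_ := nnsfun_approx mA mf.
have -> : \int[mu]_(y in A) f y = limn (fun n => \int[mu]_(y in A) (f_ n y)%:E).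
  rewrite -monotone_convergence//.
  - apply: eq_integral => y /[!inE] yD; apply/esym/cvg_lim => //.
    exact: cvg_nnsfun_approx.
  - by move=> n; exact/measurable_EFinP/measurable_funTS.
  - by move=> n y _; rewrite lee_fin.
  - by move=> y _ m n mn; rewrite lee_fin; exact/lefP/nd_nnsfun_approx.
have -> : (fun n => \int[mu]_(y in A) (f_ n y)%:E) =
    (fun n => \int[nu]_(x in D) ((w x)%:E * (f_ n (phi x))%:E)).
  by apply/funext => n; exact: integral_nnsfun.
rewrite -monotone_convergence//.
- apply: eq_integral => x /[!inE] Dx.
  apply/cvg_lim => //; apply: cvgeZl => //.
  by apply: cvg_nnsfun_approx => //; exact: DA.
- move=> n; apply: emeasurable_funM; first exact/measurable_EFinP.
  by apply/measurable_EFinP; exact: measurableT_comp.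
- by move=> n x Dx; rewrite mule_ge0 ?w0E// lee_fin.
- move=> x Dx m n mn; rewrite lee_wpmul2l ?w0E// lee_fin.
  exact/lefP/nd_nnsfun_approx.
Qed.

End DensityChangeOfVariables.

(** * Measurability in coordinates *)

Section VecMeasurable.
Context {R : realType}.

Lemma measurable_ls_coord n (i : 'I_n) :
  measurable_fun setT (fun u : ls_carrier (lebesgueN R n) => ls_vec u 0 i : R).
Proof.
elim: n i => [[]//|n IHn] i.
case: (split_ordP (i : 'I_(1 + n))) => j ->.
  rewrite [X in measurable_fun _ X](_ : _ = fst); first exact: measurable_fst.
  by apply/funext => -[t s]; rewrite /= mxE (unsplitK (inl j : 'I_1 + 'I_n)) mxE.
rewrite [X in measurable_fun _ X](_ : _ =
    (fun s : ls_carrier (lebesgueN R n) => ls_vec s 0 j : R) \o snd).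
  exact: measurableT_comp (IHn j) measurable_snd.
by apply/funext => -[t s]; rewrite /= mxE (unsplitK (inr j : 'I_1 + 'I_n)).
Qed.

(** The carrier has the product sigma-algebra, where boxes are measurable one coordinate at a time.
    An open set is the union of the rational boxes inside it, and these are countably many: a box of
    rational radius below e/2 whose rational center is within that radius of y lies in the ball of
    radius e around y. *)
Lemma measurable_ls_open n (U : set 'rV[R]_n) : open U ->
  measurable [set u : ls_carrier (lebesgueN R n) | U (ls_vec u)].
Proof.
move=> oU.
pose box (qr : 'rV[rat]_n * rat) : set 'rV[R]_n :=
  [set y | forall i, `|y 0 i - ratr (qr.1 0 i)| < ratr qr.2].
have -> : [set u : ls_carrier (lebesgueN R n) | U (ls_vec u)] =
    \bigcup_(qr in [set qr | box qr `<=` U])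
      [set u : ls_carrier (lebesgueN R n) | box qr (ls_vec u)].
  apply/seteqP; split => u /=; last by move=> [qr]; exact.
  move=> Uu; set y := ls_vec u in Uu *.
  have [e /= e0 eU] : exists2 e : R, 0 < e & ball y e `<=` U.
    by move: oU; rewrite openE => /(_ _ Uu)/nbhs_ballP.
  have e2 : 0 < e / 2 by rewrite divr_gt0.
  have [r /[!in_itv]/= /andP[r0 re]] := rat_in_itvoo e2.
  have Q i : {q : rat | `|y 0 i - ratr q| < ratr r}.
    apply: cid.
    have yr : y 0 i - ratr r < y 0 i + ratr r by rewrite ltrBlDr -addrA ltrDl addr_gt0.
    have [q /[!in_itv]/= /andP[yq qy]] := rat_in_itvoo yr.
    by exists q; rewrite ltr_distlC yq qy.
  exists (\row_i projT1 (Q i), r); last by move=> i; rewrite mxE; exact: projT2 (Q i).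
  move=> y' /= By'; apply: eU; split => // i j.
  rewrite (ord1 i) /ball/= -(subrK (ratr (projT1 (Q j))) (y 0 j)) -addrA.
  apply: le_lt_trans (ler_normD _ _) _.
  rewrite (splitr e) ltrD//.
    by apply: lt_trans re; exact: projT2 (Q j).
  by apply: lt_trans re; rewrite distrC; have := By' j; rewrite mxE.
rewrite bigcup_mkcond; apply: countable_bigcupT_measurable; first exact: countableP.
move=> qr.
case: ifPn => // _.
rewrite [X in measurable X](_ : _ = \bigcap_(i in [set: 'I_n])
    [set u : ls_carrier (lebesgueN R n) | `|ls_vec u 0 i - ratr (qr.1 0 i)| < ratr qr.2]).
  apply: fin_bigcap_measurable => // i _.
  have := @measurable_ls_coord n i measurableT
    [set` `](ratr (qr.1 0 i) - ratr qr.2), (ratr (qr.1 0 i) + ratr qr.2)[].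
  rewrite setTI => /(_ (measurable_itv _)).
  congr measurable; apply/seteqP; split => u /=; by rewrite in_itv/= ltr_distl.
by apply/seteqP; split => u /= H i; [move=> _|]; exact: H.
Qed.

End VecMeasurable.

Lemma measurable_fun_borel d (X : measurableType d) (M : ptopologicalType)
    (D : set X) (f : X -> borel M) :
  (forall U : set M, open U -> measurable (D `&` f @^-1` U)) ->
  measurable_fun D f.
Proof.
move=> H; apply: (@measurability _ _ _ _ D f (@open M)) => //.
by move=> _ [U oU <-]; exact: H.
Qed.

Lemma measurable_fun_open_preimage d (X : measurableType d) (R : realType)
    (D : set X) (f : X -> R) :
  (forall U : set R, open U -> measurable (D `&` f @^-1` U)) ->
  measurable_fun D f.
Proof.
move=> H; apply: (measurability _ (RGenOpens.measurableE R)).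
by move=> _ [_ [a [b ->] <-]]; apply: H; exact: interval_open.
Qed.

Lemma open_continuous_on (T U : topologicalType) (W : set T) (g : T -> U)
    (B : set U) : open W -> (forall x, W x -> {for x, continuous g}) ->
  open B -> open (W `&` g @^-1` B).
Proof.
move=> oW cg oB; rewrite openE => x [Wx Bx]; apply: filterI.
  exact: open_nbhs_nbhs.
by apply: (cg _ Wx); exact: open_nbhs_nbhs.
Qed.

Lemma continuous_measurable_borel (R : realType) (M : ptopologicalType)
    (f : M -> R) : continuous f -> measurable_fun setT (f : borel M -> R).
Proof.
move=> cf; apply: measurable_fun_open_preimage => U oU.
rewrite setTI; apply: sub_sigma_algebra.
by apply: open_comp => // x _; exact: cf.
Qed.

Section ChartIntegral.
Context {R : realType} {n : nat} {M : ptopologicalType}.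
Variable V : directed_volume_space R n M.
Variable mu : {measure set (borel M) -> \bar R}.
Hypothesis hmu : volume_measure V mu.
Local Notation L := (lebesgueN R n.+1).
Local Notation leb := (@lebesgue_measure R).
Implicit Types (c : chart R n.+1 M).

Lemma measurable_dom c : measurable (dom c : set (borel M)).
Proof. by apply: sub_sigma_algebra; exact: dom_open. Qed.

Definition chart_dom c : set (ls_carrier L) := [set u | img c (ls_vec u)].

Lemma measurable_chart_dom c : measurable (chart_dom c).
Proof. by apply: measurable_ls_open; exact: img_open. Qed.

Lemma measurable_from c :
  measurable_fun (chart_dom c) (fun u => from c (ls_vec u) : borel M).
Proof.
apply: measurable_fun_borel => U oU.
apply: (@measurable_ls_open _ _ (img c `&` from c @^-1` U)).
apply: open_continuous_on => //; first exact: img_open.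
exact: from_continuous.
Qed.

Lemma measurable_density c : atlas V c ->
  measurable_fun (chart_dom c) (fun u => density V c (from c (ls_vec u))).
Proof.
move=> Vc; apply: measurable_fun_open_preimage => U oU.
apply: (@measurable_ls_open _ _
  (img c `&` (fun y => density V c (from c y)) @^-1` U)).
apply: open_continuous_on => //; first exact: img_open.
by move=> y; exact: density_continuous.
Qed.

Lemma ge0_integral_chart c (A : set (borel M)) (f : borel M -> \bar R) :
  atlas V c -> measurable A -> A `<=` dom c -> measurable_fun A f ->
  (forall x, A x -> 0 <= f x)%E ->
  (\int[mu]_(x in A) f x =
   \int[ls_measure L]_(u in chart_dom c `&` (fun u => from c (ls_vec u)) @^-1` A)
     ((density V c (from c (ls_vec u)))%:E * f (from c (ls_vec u))))%E.
Proof.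
move=> Vc mA Ac mf f0.
have mD := @measurable_from c (measurable_chart_dom c) _ mA.
apply: ge0_integral_density => //.
- by apply: measurable_funS; [exact: (measurable_chart_dom c)|exact: subIsetl|
    exact: measurable_from].
- by apply: measurable_funS; [exact: (measurable_chart_dom c)|exact: subIsetl|
    exact: measurable_density].
- by move=> u [cu _]; rewrite ltW// density_gt0//; exact: from_dom.
- by move=> u [].
(* [volume_measure] integrates over the image of B under [to c]; within [img c] this is the preimage
   of B under [from c]. *)
- move=> B mB BA; rewrite (hmu Vc mB (subset_trans BA Ac)) /integralN.
  congr (integral _ _ _); apply/seteqP; split => u /=.
    move=> [x Bx xu]; have cx : dom c x by exact/Ac/BA.
    rewrite /chart_dom /= -xu toK//; split => //; split; first exact: to_img.
    exact: BA.
  by move=> [[cu Au] Bu]; exists (from c (ls_vec u)) => //; exact: fromK.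
Qed.

End ChartIntegral.

(** * Fubini along the integral curves *)

Section FubiniChart.
Context {R : realType} {n : nat} {M : ptopologicalType}.
Variable V : directed_volume_space R n M.
Variable mu : {measure set (borel M) -> \bar R}.
Hypothesis hmu : volume_measure V mu.
Local Notation leb := (@lebesgue_measure R).
Local Notation nu := (ls_measure (lebesgueN R n)).
Implicit Types (c : chart R n.+1 M).

Definition fiber_piece c (A : set M) (s : 'rV[R]_n) : set R :=
  [set t | fiber c s t /\ A (from c (pt t s))].

Definition fiber_integral c (A : set M) (f : M -> \bar R)
    (y : ls_carrier (lebesgueN R n)) : \bar R :=
  (\int[leb]_(t in fiber_piece c A (ls_vec y))
    ((Omega V c t (ls_vec y))%:E * f (from c (pt t (ls_vec y)))))%E.

Section OnePiece.
Variables (c : chart R n.+1 M) (A : set (borel M)) (f : borel M -> \bar R).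
Hypotheses (Vc : atlas V c) (mA : measurable A) (Ac : A `<=` dom c).
Hypotheses (mf : measurable_fun A f) (f0 : forall x, A x -> (0 <= f x)%E).

Let L := lebesgueN R n.+1.
Let D : set (ls_carrier L) :=
  chart_dom c `&` (fun u => from c (ls_vec u)) @^-1` A.
Let F (u : ls_carrier L) : \bar R :=
  ((density V c (from c (ls_vec u)))%:E * f (from c (ls_vec u)))%E.

Let mD : measurable D.
Proof. exact: (@measurable_from _ _ _ c (measurable_chart_dom c) _ mA). Qed.

Let mF : measurable_fun setT (F \_ D).
Proof.
apply/(measurable_restrictT _ _).1 => //.
apply: emeasurable_funM.
  apply/measurable_EFinP.
  by apply: measurable_funS; [exact: (measurable_chart_dom c)|exact: subIsetl|
    exact: measurable_density].
apply: (@measurable_comp _ _ _ _ _ _ A f D (fun u => from c (ls_vec u) : borel M)) => //.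
  by move=> _ [u [_ Au] <-].
by apply: measurable_funS; [exact: (measurable_chart_dom c)|exact: subIsetl|
    exact: measurable_from].
Qed.

Let F0 u : (0 <= (F \_ D) u)%E.
Proof.
rewrite patchE; case: ifPn => // /set_mem[cu Au].
by rewrite /F mule_ge0 ?f0// lee_fin ltW// density_gt0//; exact: from_dom.
Qed.

Let fiber_integralE y :
  fiber_integral c A f y = (\int[leb]_t (F \_ D) (t, y))%E.
Proof.
rewrite /fiber_integral integral_mkcond; apply: eq_integral => t _.
rewrite !patchE.
(* True by computation: [lebesgueN] adds t as the first factor, and [ls_vec (t, y)] reduces to
   [pt t (ls_vec y)]. *)
have -> : ((t, y) \in D) = (t \in fiber_piece c A (ls_vec y)) by [].
by [].
Qed.

Lemma measurable_fiber_integral : measurable_fun setT (fiber_integral c A f).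
Proof.
have := @measurable_fun_fubini_tonelli_G _ _ _ _ R leb (F \_ D) mF F0.
by congr measurable_fun; apply/funext => y; rewrite fiber_integralE.
Qed.

Lemma fiber_integral_ge0 y : (0 <= fiber_integral c A f y)%E.
Proof. by rewrite fiber_integralE; apply: integral_ge0. Qed.

Lemma integral_fiber_integral :
  (\int[mu]_(x in A) f x = \int[nu]_y fiber_integral c A f y)%E.
Proof.
rewrite (ge0_integral_chart hmu Vc mA Ac mf f0) integral_mkcond.
rewrite (@fubini_tonelli2 _ _ _ _ R leb nu (F \_ D) mF F0).
by apply: eq_integral => y _; rewrite fiber_integralE.
Qed.

End OnePiece.
End FubiniChart.

(** * From the fibers to the manifold *)

Section HardyPiece.
Context {R : realType} {n : nat} {M : ptopologicalType}.
Variable V : directed_volume_space R n M.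
Variable mu : {measure set (borel M) -> \bar R}.
Hypothesis hmu : volume_measure V mu.
Variables (p : R) (phi : M -> R).
Hypotheses (p1 : 1 < p) (tr : traceable V p) (phi1 : C1c V phi).

Lemma Xderive_continuous : continuous (Xderive V phi).
Proof.
move=> x; have [c [[[nc _ _] _] cx]] := tr x; have [phiC _] := phi1.
have H : {for x, continuous ((fun y => Xderive V phi (from c y)) \o to c)}.
  apply: continuous_comp; first exact: to_continuous.
  by apply: Xderive_chart_continuous => //; exact: to_img.
apply: near_eq_continuous H.
have : nbhs x (dom c) by apply: open_nbhs_nbhs; split => //; exact: dom_open.
by apply: filterS => y cy /=; rewrite toK.
Qed.

Lemma measurable_Xderive :
  measurable_fun setT (fun x : borel M => `|Xderive V phi x| `^ p).
Proof.
apply: continuous_measurable_borel => x.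
apply: (@continuous_comp _ _ _ (Xderive V phi) (fun y => `|y| `^ p)).
  exact: Xderive_continuous.
by apply: continuous_normr_powR; exact: lt_trans p1.
Qed.

(** As A contains every fiber of c that it meets, each inner integral of Fubini runs over the empty
    set or over a whole fiber. On a mere part of a fiber [hardy_chart] would not apply, since phi
    need not vanish where the part ends. *)
Lemma hardy_piece (c : chart R n.+1 M) (A : set (borel M)) (h : borel M -> R) :
  traceable_chart V p c -> measurable A -> A `<=` dom c ->
  (forall s t t', fiber c s t -> fiber c s t' ->
    A (from c (pt t s)) -> A (from c (pt t' s))) ->
  measurable_fun setT h -> (forall x, 0 <= h x) ->
  (forall x, h x <= `|phi x| `^ p / tau V p x `^ p) ->
  (\int[mu]_(x in A) (h x)%:E <= ((p / (p - 1)) `^ p)%:E *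
    \int[mu]_(x in A) (`|Xderive V phi x| `^ p)%:E)%E.
Proof.
move=> tc mA Ac Asat mh h0 hle; have [[[Vc _] _ _] _] := tc.
have mhA : measurable_fun A (EFin \o h).
  by apply/measurable_EFinP; exact: measurable_funTS.
have mXA : measurable_fun A (fun x => (`|Xderive V phi x| `^ p)%:E).
  by apply/measurable_EFinP; apply: measurable_funTS; exact: measurable_Xderive.
have X0 (x : M) : A x -> (0 <= (`|Xderive V phi x| `^ p)%:E)%E.
  by move=> _; rewrite lee_fin powR_ge0.
have h0' x : A x -> (0 <= (EFin \o h) x)%E by move=> _; rewrite lee_fin.
rewrite (integral_fiber_integral hmu Vc mA Ac mhA h0').
rewrite (integral_fiber_integral hmu Vc mA Ac mXA X0).
rewrite -ge0_integralZl//; last 3 first.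
- exact: (measurable_fiber_integral Vc mA mXA X0).
- by move=> y _; exact: fiber_integral_ge0.
- by rewrite lee_fin powR_ge0.
apply: ge0_le_integral => //.
- by move=> y _; exact: fiber_integral_ge0.
- exact: (measurable_fiber_integral Vc mA mhA h0').
- apply: measurable_funeM; exact: (measurable_fiber_integral Vc mA mXA X0).
move=> y _; set s := ls_vec y.
rewrite /fiber_integral -/s.
have [[t0 [ct0 At0]]|N] := pselect (exists t, fiber_piece c A s t); last first.
  have -> : fiber_piece c A s = set0.
    by apply/seteqP; split => // t At; apply: N; exists t.
  by rewrite !integral_set0 mule0.
have -> : fiber_piece c A s = fiber c s.
  apply/seteqP; split => t; first by case.
  by move=> ct; split => //; exact: Asat At0.
have mhs : measurable_fun (fiber c s) (fun t => h (from c (pt t s))).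
  apply: (@measurable_comp _ _ _ _ _ _ setT h _
    (fun t => from c (pt t s) : borel M)) => //.
  apply: measurable_fun_borel => U oU; apply: open_measurable.
  apply: (open_continuous_on (@fiber_open _ _ _ _ _)) => // t ct.
  have E : (fun t => from c (pt t s)) = from c \o line (pt 0 s).
    by apply/funext => u /=; rewrite -ptE.
  rewrite E; apply: continuous_comp; first exact: continuous_line.
  by apply: from_continuous; rewrite -ptE.
have := hardy_chart p1 tr phi1 tc h0 hle mhs.
have swap (k : R -> R) : (\int[@lebesgue_measure R]_(t in fiber c s)
      (k t * Omega V c t s)%:E =
    \int[@lebesgue_measure R]_(t in fiber c s) ((Omega V c t s)%:E * (k t)%:E))%E.
  by apply: eq_integral => t _; rewrite EFinM muleC.
by rewrite !swap.
Qed.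

Lemma seqDU_chart_saturated (F : (set M)^nat) k c :
  saturated_normal_chart V c -> F k = dom c ->
  (forall j, F j = set0 \/
    exists2 d, saturated_normal_chart V d & F j = dom d) ->
  forall s t t', fiber c s t -> fiber c s t' ->
    seqDU F k (from c (pt t s)) -> seqDU F k (from c (pt t' s)).
Proof.
move=> sc Fk Fj s t t' ct ct'; rewrite /seqDU -!bigcup_mkord => -[_ NF].
split; first by rewrite Fk; exact: from_dom.
move=> [j jk Fjt']; apply: NF; exists j => //.
case: (Fj j) => [F0|[d sd Fd]]; first by rewrite F0 in Fjt'.
rewrite Fd in Fjt' *.
(* The curve starts at the point of parameter t', which lies in the earlier domain [dom d]; after
   the time t - t' it is at the point of parameter t, still in [dom d]. *)
have := @chart_curve_dom _ _ _ _ c d (from c (pt t' s)) sc sd (from_dom ct')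
  Fjt' (t - t').
rewrite /chart_times /chart_curve /= fromK// -pt_line subrKC.
exact.
Qed.

Import HBNNSimple.

Lemma le_ge0_integral (f : borel M -> R) (a : \bar R) : (forall x, 0 <= f x) ->
  (forall h : {nnsfun borel M >-> R}, (forall x, h x <= f x) ->
    (\int[mu]_x (h x)%:E <= a)%E) ->
  (\int[mu]_x (f x)%:E <= a)%E.
Proof.
move=> f0 H; rewrite ge0_integralTE; last by move=> x; rewrite lee_fin.
apply: ge_ereal_sup => _ [h /= hf <-]; rewrite -integralT_nnsfun; apply: H => x.
by rewrite -lee_fin; exact: hf.
Qed.

Lemma chart_cover : exists F : (set (borel M))^nat,
  \bigcup_k F k = setT /\
  forall k, F k = set0 \/ exists2 c, traceable_chart V p c & F k = dom c.
Proof.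
have [B cB [Bo Bx]] := manifold_second_countable V.
have /countable_injP[e einj] := cB.
pose P k (bc : set M * chart R n.+1 M) :=
  [/\ B bc.1, e bc.1 = k, traceable_chart V p bc.2 & bc.1 `<=` dom bc.2].
pose F k : set M :=
  if pselect (exists bc, P k bc) is left H then dom (projT1 (cid H)).2 else set0.
exists F; split.
  apply/seteqP; split => // x _.
  have [c [tc cx]] := tr x.
  have [b [/= Bb bx] bc] : filter_from [set U | B U /\ U x] id (dom c).
    by apply: Bx; apply: open_nbhs_nbhs; split => //; exact: dom_open.
  exists (e b) => //; rewrite /F; case: pselect => [H|]; last first.
    by case; exists (b, c).
  case: cid => -[b' c'] [/= Bb' eb' tc' bc'] /=.
  (* The choice at index [e b] need not return the pair (b, c), but injectivity of e forces the same
     basic set, and x lies in it. *)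
  have bb : b' = b by apply: einj; rewrite ?inE.
  by apply: bc'; rewrite bb.
move=> k; rewrite /F; case: pselect => [H|]; last by left.
by right; case: cid => -[b c] [/= _ _ tc _]; exists c.
Qed.

Lemma hardy_nnsfun (h : {nnsfun borel M >-> R}) :
  (forall x, h x <= `|phi x| `^ p / tau V p x `^ p) ->
  (\int[mu]_x (h x)%:E <= ((p / (p - 1)) `^ p)%:E *
    \int[mu]_x (`|Xderive V phi x| `^ p)%:E)%E.
Proof.
move=> hle; have [F [FT FE]] := chart_cover.
have mF k : measurable (F k).
  by case: (FE k) => [->|[c _ ->]]; [exact: measurable0|exact: measurable_dom].
have mA := seqDU_measurable mF.
have pieces (f : borel M -> R) : measurable_fun setT f -> (forall x, 0 <= f x) ->
    (\int[mu]_x (f x)%:E = \sum_(k <oo) \int[mu]_(x in seqDU F k) (f x)%:E)%E.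
  move=> mf f0; rewrite -FT seqDU_bigcup_eq.
  apply: (@ge0_integral_bigcup _ _ _ mu (seqDU F) (EFin \o f)).
  - exact: mA.
  - by apply/measurable_EFinP; exact: measurable_funTS.
  - by move=> x _; rewrite /= lee_fin.
  - exact: trivIset_seqDU.
rewrite (pieces h)// (pieces (fun x => `|Xderive V phi x| `^ p)); last 2 first.
- exact: measurable_Xderive.
- by move=> x; exact: powR_ge0.
rewrite -nneseriesZl; last first.
  by move=> k _; apply: integral_ge0 => x _; rewrite lee_fin powR_ge0.
apply: lee_nneseries => [k _ _|k _].
  by apply: integral_ge0 => x _; rewrite lee_fin.
have sub : seqDU F k `<=` F k by exact: subset_seqDU.
case: (FE k) => [F0|[c tc Fc]].
  have -> : seqDU F k = set0 by apply/seteqP; split => // x /sub; rewrite F0.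
  by rewrite !integral_set0 mule0.
apply: (hardy_piece tc) => //; first by rewrite -Fc.
have [sc _] := tc.
apply: seqDU_chart_saturated => // j.
by case: (FE j) => [->|[d [sd _] ->]]; [left|right; exists d].
Qed.

End HardyPiece.

Theorem theorem5p1 (R : realType) (n : nat) (M : ptopologicalType)
    (V : directed_volume_space R n M)
    (mu : {measure set (borel M) -> \bar R}) (hmu : volume_measure V mu)
    (p : R) (hp : 1 < p) (htrace : traceable V p) :
  forall phi : M -> R, C1c V phi ->
    (\int[mu]_x (`|Xderive V phi x| `^ p)%:E >=
     (((p - 1) / p) `^ p)%:E *
       \int[mu]_x (`|phi x| `^ p / tau V p x `^ p)%:E)%E.
Proof.
move=> phi phi1.
have p0 : 0 < p by exact: lt_trans hp.
have p10 : 0 < p - 1 by rewrite subr_gt0.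
have H : (\int[mu]_x (`|phi x| `^ p / tau V p x `^ p)%:E <=
    ((p / (p - 1)) `^ p)%:E * \int[mu]_x (`|Xderive V phi x| `^ p)%:E)%E.
  apply: le_ge0_integral => [x|h]; first by rewrite divr_ge0 ?powR_ge0.
  exact: hardy_nnsfun.
(* Both integrals may be infinite, so instead of dividing by q^p the bound is multiplied by the
   nonnegative constant q^(-p). *)
have C0 : (0 <= (((p - 1) / p) `^ p)%:E)%E by rewrite lee_fin powR_ge0.
apply: le_trans (lee_wpmul2l C0 H) _.
rewrite muleA -EFinM -powRM ?divr_ge0 ?(ltW p0) ?(ltW p10)//.
have -> : (p - 1) / p * (p / (p - 1)) = 1.
  by field; rewrite !gt_eqF.
by rewrite powR1 mul1e.
Qed.
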